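(* Assume the reference-KKT-point, regularity-and-compatibility, nonlinearity, approximability, trace-residual-bound and local-neighborhood hypotheses stated in the context, and let $\alpha>\alpha_0$, with $\alpha_0,C_{\rm stab},C'_{\rm stab}$ the linearized-stability constants described in the context. There are constants $C_{\rm nl}>0$ and \[ \rho_0:=\frac1{2C_{\rm stab}C_{\rm nl}}>0, \] depending only on the reference KKT point, the local Lipschitz bound for $f''$, and the linearized-stability constants, such that the following holds. Whenever the radius $\rho$ in the local-neighborhood hypothesis satisfies $\rho\le\rho_0$, the trained triple $(Y_\theta,\Lambda_\phi,U_\psi)$, with errors $e_y:=y^*-Y_\theta$, $e_\lambda:=\lambda^*-\Lambda_\phi$, $e_u:=u^*-U_\psi|_\Sigma$, satisfies \[ \|(e_y,e_\lambda,e_u)\|_{\mathcal E}\le2C_{\rm stab}\mathfrak R+2C'_{\rm stab}M_{\rm bc}, \] where \[ \mathfrak R:=\|e_{y,0}\|_{L^2(\Omega)}+\|\mathcal R_y\|_{L^2(Q)}+\|\mathcal R_\lambda\|_{L^2(Q)}+\|\mathcal R_u\|_{L^2(\Sigma)}+\|R^y_{\rm bc}\|_{L^2(\Sigma)} . \]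
   Context: Setting. $d\ge1$; $\Omega\subset\mathbb R^d$ is a bounded domain with $C^{2+\beta}$ boundary for some $\beta\in(0,1)$; $T>0$, $Q:=\Omega\times(0,T)$, $\Sigma:=\partial\Omega\times(0,T)$; $n$ is the outward unit normal and $\partial_nv:=\nabla_xv\cdot n$ (for $d=1$ integrals over $\partial\Omega$ use counting measure). Fix $\nu>0$, $\alpha>0$, $g,y_d\in L^2(Q)$, $y_0\in L^2(\Omega)$, $f:\mathbb R\to\mathbb R$. The control problem is to minimize $J(y,u)=\frac12\int_Q|y-y_d|^2dx\,dt+\frac\alpha2\int_\Sigma|u|^2ds\,dt$ over $u\in L^2(\Sigma)$ subject to $\partial_ty-\nu\Delta y+f(y)=g$ in $Q$, $y=u$ on $\Sigma$, $y(\cdot,0)=y_0$ in $\Omega$, the state equation being understood in the transposition (very weak) sense (by duality against a regular backward dual problem with homogeneous Dirichlet and terminal data), the state belonging at least to $L^2(Q)$. The KKT system is: $\partial_ty-\nu\Delta y+f(y)-g=0$ and $-\partial_t\lambda-\nu\Delta\lambda+f'(y)\lambda+(y-y_d)=0$ in $Q$; $\alpha u+\nu\partial_n\lambda=0$, $y=u$, $\lambda=0$ on $\Sigma$; $y(\cdot,0)=y_0$, $\lambda(\cdot,T)=0$ in $\Omega$. Hölder spaces. $C^{\beta,\beta/2}(\overline Q)$: Hölder continuity of order $\beta$ in $x$ and $\beta/2$ in $t$. $C^{2+\beta,1+\beta/2}(\overline Q)$: additionally second spatial derivatives and the first time derivative lie in $C^{\beta,\beta/2}(\overline Q)$. $C^{2+\beta,1+\beta/2}(\Sigma)$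 is the analogous space on the lateral boundary manifold. Reference-KKT-point hypothesis: the problem admits a local optimal pair $(y^*,u^* )$ and an adjoint $\lambda^*$ (all fixed) solving the KKT system, the state equation in the transposition sense, the adjoint equation in the standard variational sense, the stationarity relation in $L^2(\Sigma)$ (under the next hypothesis all equations and traces are classical). Regularity-and-compatibility hypothesis: $\partial\Omega\in C^{2+\beta}$, $y_0\in C^{2+\beta}(\overline\Omega)$, $g,y_d\in C^{\beta,\beta/2}(\overline Q)$, $u^*\in C^{2+\beta,1+\beta/2}(\Sigma)$, and $y_0=u^*(\cdot,0)$, $\partial_tu^*(\cdot,0)=\nu\Delta y_0-f(y_0)+g(\cdot,0)$ on $\partial\Omega$. Nonlinearity hypothesis: $f\in C^2(\mathbb R)$, $f'(s)\ge-c_f$ for all $s$ for some $c_f\ge0$, and $f''$ is bounded on bounded sets. Approximability hypothesis: with $\widetilde u^*$ a fixed extension of $u^*$ from $\Sigma$ to $\overline Q$, the network classes, indexed by a resolution $N\in\mathbb N$, contain feedforward $\tanh$ networks for which there is a sequence $\epsilon_{\rm net}(N)\to0$ with $\inf_{\theta,\psi,\phi}(\|y^*-Y_\theta\|_{W^{2,\infty}(Q)}+\|\lambda^*-\Lambda_\phi\|_{W^{2,\infty}(Q)}+\|\widetilde u^*-U_\psi\|_{W^{1,\infty}(Q)})\le\epsilon_{\rm net}(N)$, where $W^{k,\infty}(Q)$ is the isotropic Sobolev space in all $d+1$ space-time variables. Networks and residuals. $Y_\theta,\Lambda_\phi,U_\psi:\overline Q\to\mathbb R$ are feedforward $\tanh$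 neural networks (state, adjoint, control), with residuals $\mathcal R_y:=\partial_tY_\theta-\nu\Delta Y_\theta+f(Y_\theta)-g$ and $\mathcal R_\lambda:=-\partial_t\Lambda_\phi-\nu\Delta\Lambda_\phi+f'(Y_\theta)\Lambda_\phi+Y_\theta-y_d$ in $Q$; $\mathcal R_u:=\alpha U_\psi+\nu\partial_n\Lambda_\phi$, $R^y_{\rm bc}:=(Y_\theta-U_\psi)|_\Sigma$, $R^\lambda_{\rm bc}:=\Lambda_\phi|_\Sigma$ on $\Sigma$; $R^\lambda_T:=\Lambda_\phi(\cdot,T)$ and $e_{y,0}:=y_0-Y_\theta(\cdot,0)$ in $\Omega$. Trace-residual-bound hypothesis: along the sequence of trained networks under consideration, $\|R^y_{\rm bc}\|_{C^{2+\beta,1+\beta/2}(\Sigma)}\le M_{\rm bc}$, $\|R^\lambda_{\rm bc}\|_{C^{2+\beta,1+\beta/2}(\Sigma)}\le M_{\rm bc}$, $\|R^\lambda_T\|_{C^{2+\beta}(\overline\Omega)}\le M_{\rm bc}$ for some $M_{\rm bc}<\infty$ independent of network size. (The corner agreement $R^\lambda_{\rm bc}(x,T)=R^\lambda_T(x)$, $x\in\partial\Omega$, is automatic.) Local-neighborhood hypothesis: for the trained triples considered there is a radius $\rho>0$ with $\|Y_\theta-y^*\|_{L^\infty(Q)}+\|\Lambda_\phi-\lambda^*\|_{L^\infty(Q)}\le\rho$; moreover there is a compact interval $I\subset\mathbb R$ containing the ranges of $y^*$ and of all trained states considered such that $f''$ is Lipschitz on $I$. Error norm: $\|(e_y,e_\lambda,e_u)\|_{\mathcal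 E}^2:=\|e_y\|_{L^2(Q)}^2+\|e_\lambda\|_{L^2(0,T;H^1(\Omega))}^2+\|e_u\|_{L^2(\Sigma)}^2$. Linearized-stability constants. Let $a:=f'(y^* )$, $M_a:=\|a\|_{L^\infty(Q)}$, $\kappa:=f''(y^* )\lambda^*$, $M_\kappa:=\sup_{\overline Q}|\kappa|$. $C_2,C_3>0$ are constants depending only on $\nu,\Omega,T,c_f,M_a$, and $\alpha_0:=4\sqrt2\,\nu(1+M_\kappa)\sqrt{C_2}\,C_3$. For $\alpha>\alpha_0$, $C_{\rm stab}$ (depending on $\nu,\Omega,T,c_f,M_a,M_\kappa,\alpha$) and $C'_{\rm stab}$ (depending additionally on a parabolic Schauder constant for the operator with coefficient $a$) are constants such that, for arbitrary forcings $F_y,F_\lambda\in L^2(Q)$, every solution of $\partial_te_y-\nu\Delta e_y+ae_y=F_y$ in $Q$, $e_y=e_u-R^y_{\rm bc}$ on $\Sigma$, $e_y(\cdot,0)=e_{y,0}$; $-\partial_te_\lambda-\nu\Delta e_\lambda+ae_\lambda+(\kappa+1)e_y=F_\lambda$ in $Q$, $e_\lambda=-R^\lambda_{\rm bc}$ on $\Sigma$, $e_\lambda(\cdot,T)=-R^\lambda_T$; $\alpha e_u+\nu\partial_ne_\lambda=-\mathcal R_u$ on $\Sigma$, satisfies $\|(e_y,e_\lambda,e_u)\|_{\mathcal E}\le C_{\rm stab}(\|e_{y,0}\|_{L^2(\Omega)}+\|F_y\|_{L^2(Q)}+\|F_\lambda\|_{L^2(Q)}+\|\mathcal R_u\|_{L^2(\Sigma)}+\|R^y_{\rm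 bc}\|_{L^2(\Sigma)})+C'_{\rm stab}M_{\rm bc}$. *)

(* Defs.v *)
(* Space-time points are pairs (x, t) : 'rV[R]_d * R.  Functions on closure Q,
   on Omega or on the lateral boundary are total functions of which only the
   values on the relevant set are ever used. *)
From HB Require Import structures.
From mathcomp Require Import all_boot all_order all_algebra.
From mathcomp Require Import all_classical all_reals all_analysis.
Set Implicit Arguments.
Unset Strict Implicit.
Unset Printing Implicit Defensive.
Import Order.TTheory GRing.Theory Num.Theory.
Import numFieldNormedType.Exports.
Local Open Scope classical_set_scope.
Local Open Scope ring_scope.

Definition norm2 {R : realType} {n : nat} (x : 'rV[R]_n) : R :=
  Num.sqrt (\sum_(i < n) x 0 i ^+ 2).

(* [mu_ext] of a gauge defined on all subsets (the generated sigma-algebra is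
   the discrete one) is the infimum over all countable covers. *)
Section CoverOuterMeasure.
Context {R : realType} {T : pointedType} (gauge : set T -> \bar R).
Local Open Scope ereal_scope.

Definition cover_outer : set T -> \bar R :=
  @mu_ext _ (g_sigma_algebraType [set: set T]) R gauge.

Hypothesis gauge0 : gauge set0 = 0.
Hypothesis gauge_ge0 : forall A, 0 <= gauge A.

Lemma cover_outer0 : cover_outer set0 = 0.
Proof. exact: mu_ext0. Qed.

Lemma cover_outer_ge0 A : 0 <= cover_outer A.
Proof. exact: mu_ext_ge0. Qed.

Lemma le_cover_outer : {homo cover_outer : A B / A `<=` B >-> A <= B}.
Proof.
exact: (@le_mu_ext _ (g_sigma_algebraType [set: set T]) R gauge).
Qed.

Lemma cover_outer_sigma_subadditive : sigma_subadditive cover_outer.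
Proof.
exact: (@mu_ext_sigma_subadditive _ (g_sigma_algebraType [set: set T]) R gauge
  gauge_ge0).
Qed.

End CoverOuterMeasure.

Section Lebesgue.
Context {R : realType} {n : nat}.
Local Notation X := 'rV[R]_n.

Definition box (a b : X) : set X := [set x | forall i, a 0 i <= x 0 i < b 0 i].

Definition box_volume (a b : X) : R := \prod_(i < n) Num.max 0 (b 0 i - a 0 i).

Local Open Scope ereal_scope.

Definition box_gauge (A : set X) : \bar R :=
  if `[< A = set0 >] then 0
  else ereal_inf [set (box_volume p.1 p.2)%:E
                 | p in [set p : X * X | A `<=` box p.1 p.2]].

Lemma box_gauge0 : box_gauge set0 = 0.
Proof. by rewrite /box_gauge; case: ifPn => // /asboolPn. Qed.

Lemma box_gauge_ge0 A : 0 <= box_gauge A.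
Proof.
rewrite /box_gauge; case: ifPn => // _.
apply: le_ereal_inf_tmp => _ [p _ <-]; rewrite lee_fin.
by apply: prodr_ge0 => i _; rewrite le_max lexx.
Qed.

Definition leb : set X -> \bar R := cover_outer box_gauge.

HB.instance Definition _ := isOuterMeasure.Build R X leb
  (cover_outer0 box_gauge0 box_gauge_ge0) (cover_outer_ge0 box_gauge_ge0)
  (@le_cover_outer R X box_gauge)
  (cover_outer_sigma_subadditive box_gauge_ge0).

End Lebesgue.
Arguments leb {R} n.

Section Hausdorff.
Context {R : realType} {n : nat}.
Local Notation X := 'rV[R]_n.

Definition unit_ball_volume (s : nat) : R :=
  fine (leb s [set x : 'rV[R]_s | norm2 x <= 1]).

Definition diam (A : set X) : R := sup [set norm2 (p.1 - p.2) | p in A `*` A].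

Local Open Scope ereal_scope.

(* 0 ^+ 0 = 1, so that the 0-dimensional measure is the counting measure. *)
Definition diam_gauge (s : nat) (delta : R) (A : set X) : \bar R :=
  if `[< A = set0 >] then 0
  else if `[< forall x y, A x -> A y -> (norm2 (x - y) <= delta)%R >]
  then (unit_ball_volume s * (diam A / 2) ^+ s)%:E
  else +oo.

Lemma diam_gauge0 s delta : diam_gauge s delta set0 = 0.
Proof. by rewrite /diam_gauge; case: ifPn => // /asboolPn. Qed.

Lemma diam_gauge_ge0 s delta A : 0 <= diam_gauge s delta A.
Proof.
rewrite /diam_gauge; case: ifPn => // _; case: ifPn => // _.
rewrite lee_fin mulr_ge0//; first by rewrite fine_ge0// outer_measure_ge0.
rewrite exprn_ge0// divr_ge0// /diam.
set S := (X in sup X); have [hS|hS] := pselect (has_sup S); last by rewrite sup_out.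
have [[r Sr] _] := hS; apply: (@le_trans _ _ r).
  by case: Sr => p _ <-; exact: sqrtr_ge0.
exact: sup_upper_bound.
Qed.

(* Normalised: on s-dimensional C^1 submanifolds this is the surface measure. *)
Definition hausdorff (s : nat) (A : set X) : \bar R :=
  ereal_sup [set cover_outer (diam_gauge s delta) A
            | delta in [set delta : R | (0 < delta)%R]].

Section OuterMeasureProofs.
Variable s : nat.

Lemma hausdorff_ge0 A : 0 <= hausdorff s A.
Proof.
apply: (@le_trans _ _ (cover_outer (diam_gauge s 1) A)).
  exact: cover_outer_ge0 (@diam_gauge_ge0 s 1) A.
by apply: ereal_sup_ubound; exists 1%R => //=.
Qed.

Lemma hausdorff0 : hausdorff s set0 = 0.
Proof.
apply/eqP; rewrite eq_le hausdorff_ge0 andbT.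
apply: ge_ereal_sup => _ [delta _ <-].
by rewrite (cover_outer0 (diam_gauge0 s delta) (@diam_gauge_ge0 s delta)).
Qed.

Lemma le_hausdorff : {homo hausdorff s : A B / A `<=` B >-> A <= B}.
Proof.
move=> A B AB; apply: ge_ereal_sup => _ [delta d0 <-].
apply: (@le_trans _ _ (cover_outer (diam_gauge s delta) B)).
  exact: le_cover_outer.
by apply: ereal_sup_ubound; exists delta.
Qed.

Lemma hausdorff_sigma_subadditive : sigma_subadditive (hausdorff s).
Proof.
move=> F; apply: ge_ereal_sup => _ [delta d0 <-].
apply: (le_trans (cover_outer_sigma_subadditive (@diam_gauge_ge0 s delta) F)).
apply: lee_nneseries => k *.
  exact: (cover_outer_ge0 (@diam_gauge_ge0 s delta)).
by apply: ereal_sup_ubound; exists delta.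
Qed.

End OuterMeasureProofs.

HB.instance Definition _ (s : nat) := isOuterMeasure.Build R X (hausdorff s)
  (hausdorff0 s) (hausdorff_ge0 s) (@le_hausdorff s)
  (@hausdorff_sigma_subadditive s).

End Hausdorff.
Arguments hausdorff {R} n s.

Section Calculus.
Context {R : realType} {n : nat}.
Local Notation X := 'rV[R]_n.
Local Notation XT := ('rV[R]_n * R)%type.

Definition pdx (i : 'I_n) (h : X -> R) : X -> R := 'D_('e_i : X) h.
Definition lap (h : X -> R) (x : X) : R := \sum_(i < n) pdx i (pdx i h) x.

(* [Some i] is the i-th space direction, [None] the time direction. *)
Definition dir (k : option 'I_n) : XT := if k is Some i then ('e_i, 0) else (0, 1).
Definition dst (k : option 'I_n) (v : XT -> R) : XT -> R := 'D_(dir k) v.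
Definition dx (i : 'I_n) (v : XT -> R) := dst (Some i) v.
Definition dt (v : XT -> R) := dst None v.
Definition lapx (v : XT -> R) (z : XT) : R := \sum_(i < n) dx i (dx i v) z.
Definition mder (s : seq (option 'I_n)) (v : XT -> R) : XT -> R := foldr dst v s.

Definition C0_on {V : topologicalType} (O : set V) (v : V -> R) :=
  forall z, O z -> {for z, continuous v}.

Definition C2_on (O : set X) (h : X -> R) :=
  [/\ C0_on O h,
      forall i, (forall x, O x -> derivable h x 'e_i) /\ C0_on O (pdx i h)
    & forall i j, (forall x, O x -> derivable (pdx j h) x 'e_i) /\
                  C0_on O (pdx i (pdx j h))].

Definition C1st_on (O : set XT) (v : XT -> R) :=
  C0_on O v /\
  forall k, (forall z, O z -> derivable v z (dir k)) /\ C0_on O (dst k v).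

Definition C21_on (O : set XT) (v : XT -> R) :=
  C1st_on O v /\
  forall i j, (forall z, O z -> derivable (dx j v) z (dir (Some i))) /\
              C0_on O (dx i (dx j v)).

Definition holder_norm {V : Type} (dist : V -> V -> R) (D : set V) (v : V -> R)
    : \bar R :=
  (ereal_sup [set (`|v z|)%:E | z in D] +
   ereal_sup [set (`|v p.1 - v p.2| / dist p.1 p.2)%:E | p in D `*` D])%E.

Definition holder_dist (beta : R) (x y : X) : R := norm2 (x - y) `^ beta.
Definition pholder_dist (beta : R) (z w : XT) : R :=
  norm2 (z.1 - w.1) `^ beta + `|z.2 - w.2| `^ (beta / 2).

(* Norms of C^{2+beta} and C^{2+beta,1+beta/2} up to the boundary: D is the
   (relatively) open set on which derivatives are taken, Dbar the set on which
   the function lives; uniformly Hoelder derivatives extend continuously. *)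
Definition C2b_norm (beta : R) (D Dbar : set X) (h : X -> R) : \bar R :=
  let N := holder_norm (holder_dist beta) D in
  if `[< {within Dbar, continuous h} /\ C2_on D h >] then
    (N h + \sum_(i < n) N (pdx i h) +
     \sum_(i < n) \sum_(j < n) N (pdx i (pdx j h)))%E
  else +oo%E.

Definition pC2b_norm (beta : R) (D Dbar : set XT) (v : XT -> R) : \bar R :=
  let N := holder_norm (pholder_dist beta) D in
  if `[< {within Dbar, continuous v} /\ C21_on D v >] then
    (N v + N (dt v) + \sum_(i < n) N (dx i v) +
     \sum_(i < n) \sum_(j < n) N (dx i (dx j v)))%E
  else +oo%E.

(* Value at a boundary point z of the continuous extension of h from A. *)
Definition trace {V : topologicalType} (A : set V) (h : V -> R) (z : V) : R :=
  lim (h @ within A (nbhs z)).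

End Calculus.

Section Domains.
Context {R : realType} {d : nat}.
Local Notation X := 'rV[R]_d.
Local Notation XT := ('rV[R]_d * R)%type.

(* Inside the ball, Omega is one side of the graph x_k = gamma(x'), where x'
   is x with its k-th coordinate deleted. *)
Record chart := Chart {
  ch_center : X;
  ch_radius : R;
  ch_axis : 'I_d;
  ch_above : bool;
  ch_graph : 'rV[R]_d.-1 -> R }.

Implicit Types (c : chart) (Omega : set X).

Definition ch_ball c : set X := [set x | norm2 (x - ch_center c) < ch_radius c].
Definition ch_sign c : R := if ch_above c then 1 else -1.

Definition ch_point c (x' : 'rV[R]_d.-1) : X :=
  \row_j (if unlift (ch_axis c) j is Some j' then x' 0 j' else ch_graph c x').

Definition ch_dom c : set 'rV[R]_d.-1 := [set x' | ch_ball c (ch_point c x')].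

(* grad(x_k - gamma(x')) points from the graph upwards. *)
Definition ch_normal c (x : X) : X :=
  let w : X := \row_j (if unlift (ch_axis c) j is Some j'
                       then - pdx j' (ch_graph c) (col' (ch_axis c) x) else 1) in
  (- ch_sign c / norm2 w) *: w.

Definition bdry Omega : set X := closure Omega `\` Omega.

Definition is_chart (beta : R) Omega c :=
  [/\ bdry Omega (ch_center c), 0 < ch_radius c,
      (C2b_norm beta setT setT (ch_graph c) < +oo)%E
    & forall x, ch_ball c x ->
        (Omega x <->
         0 < ch_sign c * (x 0 (ch_axis c) - ch_graph c (col' (ch_axis c) x)))].

Definition is_atlas (beta : R) Omega m (A : 'I_m -> chart) :=
  (forall j, is_chart beta Omega (A j)) /\
  (forall x, bdry Omega x -> exists j, ch_ball (A j) x).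

Definition outward_normal m (A : 'I_m -> chart) (x : X) : X :=
  xget 0 [set w | exists2 j, ch_ball (A j) x & w = ch_normal (A j) x].

End Domains.
Arguments chart : clear implicits.

(* [atlas] is a finite C^{2+beta} atlas of the boundary (see
   [standing_assumptions]); the Hoelder norms on Sig are read in its charts. *)
Record ocp (R : realType) (d : nat) := Ocp {
  Omega : set 'rV[R]_d;
  beta : R;
  nchart : nat;
  atlas : 'I_nchart -> chart R d;
  horizon : R;
  nu : R;
  alpha : R;
  source : 'rV[R]_d * R -> R;
  target : 'rV[R]_d * R -> R;
  init : 'rV[R]_d -> R;
  nonlin : R -> R }.

Section ControlProblem.
Context {R : realType} {d : nat} (P : ocp R d).
Local Notation X := 'rV[R]_d.
Local Notation XT := ('rV[R]_d * R)%type.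
Local Notation Omega := (Omega P).
Local Notation T := (horizon P).
Local Notation nu := (nu P).
Local Notation alpha := (alpha P).
Local Notation beta := (beta P).
Local Notation g := (source P).
Local Notation yd := (target P).
Local Notation y0 := (init P).
Local Notation f := (nonlin P).

Definition Q : set XT := Omega `*` `]0, T[%classic.
Definition Qbar : set XT := closure Omega `*` `[0, T]%classic.
Definition Sig : set XT := bdry Omega `*` `]0, T[%classic.
Definition Sigbar : set XT := bdry Omega `*` `[0, T]%classic.

(* dx, dx dt, and ds dt, the latter with ds the (d-1)-dimensional Hausdorff
   measure (the counting measure for d = 1). *)
Definition lebO : {outer_measure set X -> \bar R} := leb d.
Definition hausO : {outer_measure set X -> \bar R} := hausdorff d d.-1.
Local Notation LX := (caratheodory_type lebO).
Local Notation SX := (caratheodory_type hausO).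

Definition spvol : {measure set LX -> \bar R} := (lebO : set LX -> \bar R).
Definition stvol : {measure set (LX * measurableTypeR R) -> \bar R} :=
  (spvol \x (@lebesgue_measure R))%E.
Definition surf : {measure set SX -> \bar R} := (hausO : set SX -> \bar R).
Definition stsurf : {measure set (SX * measurableTypeR R) -> \bar R} :=
  (surf \x (@lebesgue_measure R))%E.

Definition L2Q (v : XT -> R) : \bar R := Lnorm stvol 2%:E (EFin \o (v \_ Q)).
Definition LooQ (v : XT -> R) : \bar R := Lnorm stvol +oo%E (EFin \o (v \_ Q)).
Definition L2Om (h : X -> R) : \bar R := Lnorm spvol 2%:E (EFin \o (h \_ Omega)).
Definition L2Sig (v : XT -> R) : \bar R := Lnorm stsurf 2%:E (EFin \o (v \_ Sig)).

Definition inL2Q (v : XT -> R) :=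
  measurable_fun (Q : set (LX * measurableTypeR R)) v /\
  (L2Q v < +oo)%E.
Definition inL2Om (h : X -> R) :=
  measurable_fun (Omega : set LX) h /\
  (L2Om h < +oo)%E.
Definition inL2Sig (v : XT -> R) :=
  measurable_fun (Sig : set (SX * measurableTypeR R)) v /\
  (L2Sig v < +oo)%E.

Definition standing_assumptions :=
  [/\ [/\ open Omega, connected Omega, Omega !=set0 & bounded_set Omega],
      0 < beta < 1 /\ is_atlas beta Omega (@atlas R d P),
      [/\ 0 < T, 0 < nu & 0 < alpha]
    & [/\ inL2Q g, inL2Q yd & inL2Om y0]].

(* nabla_x v . n, with nabla_x v extended to Sig from inside Q. *)
Definition dn (v : XT -> R) (z : XT) : R :=
  \sum_(i < d) trace Q (dx i v) z * outward_normal (@atlas R d P) z.1 0 i.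

(* Classical regularity: C(closure Q), C^{2,1}(Q), nabla_x up to Sig. *)
Definition classical (v : XT -> R) :=
  [/\ {within Qbar, continuous v}, C21_on Q v
    & forall z, Sig z -> forall i, cvg (dx i v @ within Q (nbhs z))].

Definition residual_y (y : XT -> R) (z : XT) : R :=
  dt y z - nu * lapx y z + f (y z) - g z.
Definition residual_l (y l : XT -> R) (z : XT) : R :=
  - dt l z - nu * lapx l z + derive1 f (y z) * l z + y z - yd z.
Definition residual_u (l u : XT -> R) (z : XT) : R := alpha * u z + nu * dn l z.

(* Very weak formulation: phi solves the backward dual problem
   - dt phi - nu Lap phi = w,  phi = 0 on Sig,  phi(T) = 0. *)
Definition transposition_solution (y u : XT -> R) :=
  stvol.-integrable Q (EFin \o (f \o y)) /\
  forall phi : XT -> R, C21_on setT phi ->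
    (forall z, Sigbar z -> phi z = 0) ->
    (forall x, closure Omega x -> phi (x, T) = 0) ->
    let w := fun z => - dt phi z - nu * lapx phi z in
    \int[stvol]_(z in Q) (y z * w z) + \int[stvol]_(z in Q) (f (y z) * phi z) =
    \int[stvol]_(z in Q) (g z * phi z) + \int[spvol]_(x in Omega) (y0 x * phi (x, 0))
    - nu * \int[stsurf]_(z in Sig) (u z * dn phi z).

Definition admissible (y u : XT -> R) :=
  [/\ inL2Q y, inL2Sig u & transposition_solution y u].

Definition cost (y u : XT -> R) : \bar R :=
  ((2^-1)%:E * \int[stvol]_(z in Q) (`|y z - yd z| ^+ 2)%:E +
   (alpha / 2)%:E * \int[stsurf]_(z in Sig) (`|u z| ^+ 2)%:E)%E.

Definition local_optimal_pair (y u : XT -> R) :=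
  admissible y u /\
  exists2 r : R, 0 < r &
    forall y' u' : XT -> R, admissible y' u' ->
      (L2Q (y' \- y)%R + L2Sig (u' \- u)%R < r%:E)%E -> (cost y u <= cost y' u')%E.

(* G is the weak gradient of l, and l lies in L^2(0,T;H^1_0): since psi need
   not vanish on the lateral boundary, the first identity includes the zero
   trace; the second one includes l(T) = 0. *)
Definition variational_adjoint (y l : XT -> R) :=
  exists G : 'I_d -> XT -> R,
  [/\ inL2Q l, forall i, inL2Q (G i),
      forall psi : XT -> R, C1st_on setT psi -> forall i,
        \int[stvol]_(z in Q) (l z * dx i psi z) =
        - \int[stvol]_(z in Q) (G i z * psi z)
    & forall v : XT -> R, C1st_on setT v ->
        (forall z, Sigbar z -> v z = 0) ->
        (forall x, closure Omega x -> v (x, 0) = 0) ->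
        \int[stvol]_(z in Q)
          (l z * dt v z + nu * \sum_(i < d) G i z * dx i v z +
           (derive1 f (y z) * l z + (y z - yd z)) * v z) = 0].

Definition reference_KKT (y l u : XT -> R) :=
  [/\ local_optimal_pair y u,
      variational_adjoint y l,
      classical y /\ classical l,
      forall z, Q z -> residual_y y z = 0 /\ residual_l y l z = 0
    & (forall z, Sig z -> [/\ residual_u l u z = 0, y z = u z & l z = 0]) /\
      (forall x, Omega x -> y (x, 0) = y0 x /\ l (x, T) = 0)].

Definition C2b_Om (h : X -> R) : \bar R := C2b_norm beta Omega (closure Omega) h.

(* Norm of C^{2+beta,1+beta/2}(Sig), read in the charts of the fixed atlas. *)
Definition C2b_Sig (v : XT -> R) : \bar R :=
  (\sum_(j < nchart P)
     let c := atlas j in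
     pC2b_norm beta (ch_dom c `*` `]0%R, T[%classic) (ch_dom c `*` `[0%R, T]%classic)
       (fun p => v (ch_point c p.1, p.2)))%E.

Definition regularity_compatibility (u : XT -> R) :=
  [/\ (C2b_Om y0 < +oo)%E,
      (holder_norm (pholder_dist beta) Qbar g < +oo)%E /\
      (holder_norm (pholder_dist beta) Qbar yd < +oo)%E,
      (C2b_Sig u < +oo)%E,
      forall x, bdry Omega x -> y0 x = u (x, 0)
    & forall x, bdry Omega x ->
        lim ((fun h : R => h^-1 * (u (x, h) - u (x, 0))) @ 0^'+) =
        nu * trace Omega (lap y0) x - f (y0 x) + g (x, 0)].

Definition nonlinearity (cf : R) :=
  [/\ (forall s : R, derivable f s 1), (forall s : R, derivable (derive1 f) s 1),
      continuous (derive1 (derive1 f)),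
      0 <= cf /\ (forall s, - cf <= derive1 f s)
    & forall A : set R, bounded_set A -> bounded_set (derive1 (derive1 f) @` A)].

Definition test_function (phi : XT -> R) :=
  (forall s z, {for z, continuous (mder s phi)} /\
               forall k, derivable (mder s phi) z (dir k)) /\
  exists K : set XT, [/\ compact K, K `<=` Q & forall z, ~ K z -> phi z = 0].

Definition weak_derivative (s : seq (option 'I_d)) (v w : XT -> R) :=
  [/\ stvol.-integrable Q (EFin \o v), stvol.-integrable Q (EFin \o w)
    & forall phi, test_function phi ->
        \int[stvol]_(z in Q) (v z * mder s phi z) =
        (-1) ^+ size s * \int[stvol]_(z in Q) (w z * phi z)].

(* max over |s| <= k of the L^oo norms of the weak derivatives of v, and +oo
   if v is not in W^{k,oo}(Q). *)
Definition Wnorm (k : nat) (v : XT -> R) : \bar R :=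
  ereal_inf [set M | exists w : seq (option 'I_d) -> XT -> R,
    forall s, (size s <= k)%N -> weak_derivative s v (w s) /\ (LooQ (w s) <= M)%E].

Definition error_norm (ey el eu : XT -> R) : \bar R :=
  ((L2Q ey ^+ 2 + (L2Q el ^+ 2 + \sum_(i < d) L2Q (dx i el) ^+ 2)
    + L2Sig eu ^+ 2) `^ 2^-1)%E.

Definition total_residual (ey0 : X -> R) (Fy Fl Ru Rbcy : XT -> R) : \bar R :=
  (L2Om ey0 + L2Q Fy + L2Q Fl + L2Sig Ru + L2Sig Rbcy)%E.

Definition trace_bound (Rbcy Rbcl : XT -> R) (RT : X -> R) (M : R) :=
  [/\ (C2b_Sig Rbcy <= M%:E)%E, (C2b_Sig Rbcl <= M%:E)%E
    & (C2b_Om RT <= M%:E)%E].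

Definition linearized_stability (a kappa : XT -> R) (C C' : R) :=
  forall (Fy Fl ey el eu Rbcy Rbcl Ru : XT -> R) (ey0 RT : X -> R) (M : R),
    inL2Q Fy -> inL2Q Fl ->
    trace_bound Rbcy Rbcl RT M ->
    (forall x, bdry Omega x -> Rbcl (x, T) = RT x) ->
    classical ey -> classical el ->
    (forall z, Q z -> dt ey z - nu * lapx ey z + a z * ey z = Fy z) ->
    (forall z, Sig z -> ey z = eu z - Rbcy z) ->
    (forall x, Omega x -> ey (x, 0) = ey0 x) ->
    (forall z, Q z -> - dt el z - nu * lapx el z + a z * el z
                      + (kappa z + 1) * ey z = Fl z) ->
    (forall z, Sig z -> el z = - Rbcl z) ->
    (forall x, Omega x -> el (x, T) = - RT x) ->
    (forall z, Sig z -> alpha * eu z + nu * dn el z = - Ru z) ->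
    (error_norm ey el eu
      <= C%:E * total_residual ey0 Fy Fl Ru Rbcy + (C' * M)%:E)%E.

Definition alpha0 (kappa : XT -> R) (C2 C3 : R) : R :=
  let Mkappa := sup [set `|kappa z| | z in Qbar] in
  4 * Num.sqrt 2 * nu * (1 + Mkappa) * Num.sqrt C2 * C3.

End ControlProblem.

Definition tanh {R : realType} (x : R) : R :=
  (expR x - expR (- x)) / (expR x + expR (- x)).

Inductive mlp (R : realType) : nat -> Type :=
| Output n of 'cV[R]_n & R : mlp R n
| Hidden n m of 'M[R]_(n, m) & 'rV[R]_m & mlp R m : mlp R n.

Fixpoint mlp_eval {R : realType} {n} (N : mlp R n) : 'rV[R]_n -> R :=
  match N in mlp _ n return 'rV[R]_n -> R with
  | Output _ w b => fun x => (x *m w) 0 0 + b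
  | Hidden _ _ W b N' => fun x => mlp_eval N' (map_mx tanh (x *m W + b))
  end.

Definition net (R : realType) (d : nat) := mlp R (d + 1).

Definition realize {R : realType} {d} (N : net R d) (z : 'rV[R]_d * R) : R :=
  mlp_eval N (row_mx z.1 z.2%:M).

(* The parameters theta, phi, psi of state, adjoint and control. *)
Record triple (R : realType) (d : nat) := Triple {
  theta : net R d; phi : net R d; psi : net R d }.

Section Training.
Context {R : realType} {d : nat} (P : ocp R d).
Local Notation X := 'rV[R]_d.
Local Notation XT := ('rV[R]_d * R)%type.
Implicit Type tr : triple R d.

Definition Ynet tr : XT -> R := realize (theta tr).
Definition Lnet tr : XT -> R := realize (phi tr).
Definition Unet tr : XT -> R := realize (psi tr).

Definition is_extension (u utilde : XT -> R) :=
  {within Qbar P, continuous utilde} /\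
  (forall z, Sigbar P z -> utilde z = u z).

Definition approximability (y l utilde : XT -> R) (class : nat -> set (triple R d)) :=
  exists2 eps : R ^nat, eps @ \oo --> (0 : R) &
    forall N, (ereal_inf [set Wnorm P 2 (y \- Ynet tr)%R + Wnorm P 2 (l \- Lnet tr)%R +
                              Wnorm P 1 (utilde \- Unet tr)%R
                         | tr in class N] <= (eps N)%:E)%E.

Definition trace_residual_bound tr (M : R) :=
  trace_bound P (Ynet tr \- Unet tr) (Lnet tr)
    (fun x => Lnet tr (x, horizon P)) M.

Definition local_neighborhood (y l : XT -> R) (trained : set (triple R d))
    (lo hi L rho : R) :=
  [/\ 0 < rho,
      forall tr, trained tr ->
        (LooQ P (Ynet tr \- y)%R + LooQ P (Lnet tr \- l)%R <= rho%:E)%E,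
      forall z, Qbar P z -> lo <= y z <= hi,
      forall tr, trained tr -> forall z, Qbar P z -> lo <= Ynet tr z <= hi
    & L.-lipschitz_(`[lo, hi]%classic) (derive1 (derive1 (nonlin P)))].

Definition triple_error (y l u : XT -> R) tr : \bar R :=
  error_norm P (y \- Ynet tr) (l \- Lnet tr) (u \- Unet tr).

Definition triple_residual tr : \bar R :=
  total_residual P (fun x => init P x - Ynet tr (x, 0))
    (residual_y P (Ynet tr)) (residual_l P (Ynet tr) (Lnet tr))
    (residual_u P (Lnet tr) (Unet tr)) (Ynet tr \- Unet tr).

End Training.

(* Main.v *)
Require Import Defs.
From mathcomp Require Import all_boot all_order all_algebra.
From mathcomp Require Import all_classical all_reals all_analysis.
From mathcomp Require Import measurable_realfun ess_sup_inf ring lra.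
Import Order.TTheory GRing.Theory Num.Theory.
Import numFieldNormedType.Exports.
Set Implicit Arguments.
Unset Strict Implicit.
Unset Printing Implicit Defensive.
Local Open Scope classical_set_scope.
Local Open Scope ring_scope.

(** The errors [e_y = y* - Y], [e_l = l* - Lam], [e_u = u* - U] of a trained
    triple solve the linearized KKT system exactly, with forcings
    [F_y = q_y - R_y] and [F_l = q_l - R_l], where [R_y] and [R_l] are the
    residuals of the networks and [q_y], [q_l] are the Taylor remainders left
    over by linearizing [f] and [f'] at [y*] ([state_error_eq] and
    [adjoint_error_eq]).

    Both remainders are quadratic in the errors.  Since [e_y] and [e_l] are
    bounded by [rho] almost everywhere and [f''] is Lipschitz on an interval
    containing all the states, one of the two factors may be replaced by
    [rho]; this gives [|q_y| + |q_l| <= Cnl rho |e_y|] in [L^2(Q)]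
    ([taylor_remainders], [remainders_le]).  Linearized stability then yields
    [E <= Cstab (Res + Cnl rho E) + Cstab' Mbc] for the error norm [E], and
    [rho <= 1 / (2 Cstab Cnl)] makes the coefficient of [E] on the right at most
    1/2, so that it can be absorbed into the left-hand side ([absorb]).

    Three points need care before stability may be invoked and the absorption
    carried out.  First, the errors must be classical, so tanh networks must be
    smooth: this is an induction on the layers, because [C^2] functions of
    space-time contain the coordinates and are stable under sums, products and
    composition with [tanh], whose derivatives are polynomials in [tanh]
    ([C2all_realize]).  Second, the forcings must be measurable for the product of
    the Caratheodory sigma-algebra of the box outer measure with the Borel one.
    Coordinate half-spaces split the volume of every box additively, hence are
    Caratheodory measurable; so are boxes, then open sets, and functions
    continuous on the open set [Q] are measurable ([C0_on_measurable]).  Third,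
    absorption requires [E] to be finite: if the total residual is infinite
    nothing has to be shown, and otherwise the forcings lie in [L^2(Q)], because
    [Q] has finite measure, so that the stability estimate itself bounds
    [E]. *)

(** * Measurability of open sets for the box outer measure *)

Section SplittingGauge.
Context {R : realType} {T : pointedType}.
Variable gauge : set T -> \bar R.
Hypothesis gauge_ge0 : forall A, (0 <= gauge A)%E.

(** Any countable cover of [A] is cut by [H] into covers of both pieces of [A],
    so additivity only has to be checked on the gauge. *)
Lemma cover_outer_split (H A : set T) :
  (forall F, gauge (F `&` H) + gauge (F `&` ~` H) <= gauge F)%E ->
  (cover_outer gauge (A `&` H) + cover_outer gauge (A `&` ~` H) <=
   cover_outer gauge A)%E.
Proof.
move=> split_gauge.
have cover (K : set T) (F : (set T)^nat) : A `<=` \bigcup_k F k ->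
    (cover_outer gauge (A `&` K) <= \sum_(k <oo) gauge (F k `&` K))%E.
  move=> AF; apply: ereal_inf_lbound; exists (fun k => F k `&` K) => //.
  split; first by move=> i; exact: sub_sigma_algebra.
  by move=> x [/AF[k _ Fkx] Kx]; exists k.
apply: le_ereal_inf_tmp => _ [F [_ AF] <-].
apply: (@le_trans _ _ (\sum_(k <oo) gauge (F k `&` H) +
    \sum_(k <oo) gauge (F k `&` ~` H))%E); first by apply: leeD; exact: cover.
rewrite -nneseriesD; [|by move=> *; exact: gauge_ge0..].
apply: lee_nneseries => k _; first by rewrite adde_ge0.
exact: split_gauge.
Qed.

End SplittingGauge.

Section BoxMeasure.
Context {R : realType} {n : nat}.
Local Notation X := 'rV[R]_n.
Implicit Types (A F : set X) (a b : X).

Definition half_space (i : 'I_n) (c : R) : set X := [set x | c <= x 0 i].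

Lemma box_gauge_le F a b : F `<=` box a b -> (box_gauge F <= (box_volume a b)%:E)%E.
Proof.
move=> Fab; rewrite /box_gauge; case: ifPn => _.
  by rewrite lee_fin; apply: prodr_ge0 => i _; rewrite le_max lexx.
by apply: ereal_inf_lbound; exists (a, b).
Qed.

(** A box containing [F] is cut by the hyperplane [x_i = c] into two boxes that
    contain the two pieces of [F] and whose volumes add up. *)
Lemma box_gauge_half_space_split i c F :
  (box_gauge (F `&` half_space i c) + box_gauge (F `&` ~` half_space i c) <= box_gauge F)%E.
Proof.
rewrite {3}/box_gauge; case: ifPn => [/asboolP->|_].
  by rewrite !set0I !box_gauge0 adde0.
apply: le_ereal_inf_tmp => _ [[a b] /= Fab <-].
pose a' : X := \row_j if j == i then Num.max (a 0 i) c else a 0 j.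
pose b' : X := \row_j if j == i then Num.min (b 0 i) c else b 0 j.
have ub : (box_gauge (F `&` half_space i c) <= (box_volume a' b)%:E)%E.
  apply: box_gauge_le => x [/Fab xab cx] j; rewrite mxE.
  by have := xab j; case: eqP => [->|//]; rewrite ge_max => /andP[-> ->]; rewrite cx.
have lb : (box_gauge (F `&` ~` half_space i c) <= (box_volume a b')%:E)%E.
  apply: box_gauge_le => x [/Fab xab /negP]; rewrite -ltNge => xc j; rewrite mxE.
  by have := xab j; case: eqP => [->|//]; rewrite lt_min => /andP[-> ->]; rewrite xc.
apply: (le_trans (leeD ub lb)); rewrite -EFinD lee_fin /box_volume.
rewrite (bigD1 i)//= [X in _ + X <= _](bigD1 i)//= [X in _ <= X](bigD1 i)//=.
rewrite !mxE eqxx.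
rewrite (eq_bigr (fun j => Num.max 0 (b 0 j - a 0 j))); last first.
  by move=> j /negbTE ji; rewrite mxE ji.
rewrite [X in _ + _ * X](eq_bigr (fun j => Num.max 0 (b 0 j - a 0 j))); last first.
  by move=> j /negbTE ji; rewrite mxE ji.
rewrite -mulrDl ler_wpM2r//.
  by apply: prodr_ge0 => j _; rewrite le_max lexx.
rewrite /Num.max /Num.min.
by repeat case: ifPn; rewrite -?leNgt; lra.
Qed.

Lemma half_space_measurable i c :
  measurable (half_space i c : set (caratheodory_type (@lebO R n))).
Proof.
apply: le_caratheodory_measurable => A; apply: cover_outer_split.
  exact: box_gauge_ge0.
exact: box_gauge_half_space_split.
Qed.

Lemma leb_box_lty a b : (leb n (box a b) < +oo)%E.
Proof.
apply: (@le_lt_trans _ _ (box_volume a b)%:E); last exact: ltry.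
apply: (@le_trans _ _ (box_gauge (box a b))); last exact: box_gauge_le.
apply: ereal_inf_lbound => /=.
exists (fun k : nat => (if k is 0%N then box a b else set0) : set X).
  split; first by move=> i; exact: sub_sigma_algebra.
  by move=> x xab; exists 0%N.
rewrite nneseries_recl//; last by move=> k _; exact: box_gauge_ge0.
rewrite eseries0 ?adde0// => -[|k]// _ _; exact: box_gauge0.
Qed.

End BoxMeasure.

Section OpenMeasurable.
Context {R : realType} {n : nat}.
Local Notation X := 'rV[R]_n.
Local Notation XT := ('rV[R]_n * R)%type.
Local Notation LXR := (caratheodory_type (@lebO R n) * measurableTypeR R)%type.

Lemma box_measurable (a b : X) :
  measurable (box a b : set (caratheodory_type (@lebO R n))).
Proof.
rewrite (_ : box a b =
    \bigcap_(i in [set: 'I_n]) (half_space i (a 0 i) `\` half_space i (b 0 i))).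
  apply: fin_bigcap_measurable => // i _.
  by apply: measurableD; exact: half_space_measurable.
apply/seteqP; split=> x.
  by move=> xab i _; have /andP[ax xb] := xab i; split=> //=; apply/negP; rewrite -ltNge.
move=> xab i; have [//= ax /negP] := xab i I.
by rewrite -ltNge ax.
Qed.

(** An open set is the countable union of the half-open boxes with rational
    corners that it contains. *)
Lemma open_spacetime_measurable (W : set XT) : open W -> measurable (W : set LXR).
Proof.
move=> oW.
pose I := (({ffun 'I_n -> rat} * {ffun 'I_n -> rat}) * (rat * rat))%type.
pose vec (q : {ffun 'I_n -> rat}) : X := \row_i ratr (q i).
pose B (p : I) : set XT :=
  box (vec p.1.1) (vec p.1.2) `*` `[ratr p.2.1, ratr p.2.2[%classic.
have -> : W = \bigcup_(p : I) (if `[< B p `<=` W >] then B p else set0).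
  apply/seteqP; split=> z; last first.
    by move=> [p _]; case: ifPn => // /asboolP; apply.
  move=> Wz; have /nbhs_ballP[e /= e0 zeW] : nbhs z W by exact: open_nbhs_nbhs.
  (* Corners within distance e below and above z: a point of the box they span
     lies within e of z. *)
  have lo (c : R) : {q : rat | c - e < ratr q < c}.
    by apply: cid; have [|q] := @rat_in_itvoo R (c - e) c; [rewrite ltrBlDr ltrDl|exists q].
  have hi (c : R) : {q : rat | c < ratr q < c + e}.
    by apply: cid; have [|q] := @rat_in_itvoo R c (c + e); [rewrite ltrDl|exists q].
  pose p : I := (([ffun i => sval (lo (z.1 0 i))], [ffun i => sval (hi (z.1 0 i))]),
                 (sval (lo z.2), sval (hi z.2))).
  have near (c x : R) : ratr (sval (lo c)) <= x < ratr (sval (hi c)) -> `|c - x| < e.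
    case: (lo c) => q /= /andP[q1 q2]; case: (hi c) => r /= /andP[r1 r2] /andP[x1 x2].
    by rewrite ltr_norml; apply/andP; split; lra.
  have mid (c : R) : ratr (sval (lo c)) <= c < ratr (sval (hi c)).
    case: (lo c) => q /= /andP[q1 q2]; case: (hi c) => r /= /andP[r1 r2].
    by rewrite (ltW q2) r1.
  have BW : B p `<=` W.
    move=> y [/= y1 y2]; apply: zeW; split.
      split=> // i j; rewrite ord1; apply: near.
      by have := y1 j; rewrite !mxE !ffunE.
    by apply: near; move: y2; rewrite in_itv.
  exists p => //; case: ifPn => [_|/asboolPn//].
  by split=> [i|] /=; rewrite ?mxE ?ffunE ?in_itv; exact: mid.
apply: countable_bigcupT_measurable => [|p]; [exact: (@countableP I)|case: ifPn => // _].
apply: measurableX; first exact: box_measurable.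
exact: measurable_itv.
Qed.

Lemma C0_on_measurable (W : set XT) (v : XT -> R) : open W -> C0_on W v ->
  measurable_fun (W : set LXR) v.
Proof.
move=> oW cv mW; apply: (measurability _ (RGenOInfty.measurableE R)).
move=> _ [_ [a ->] <-]; apply: open_spacetime_measurable.
rewrite openE => z [Wz vz]; apply: filterI; first exact: open_nbhs_nbhs.
by apply: (cv z Wz); apply: open_nbhs_nbhs; split => //; exact: interval_open.
exact: open_spacetime_measurable.
Qed.

End OpenMeasurable.

(** * Smoothness of tanh networks *)

Section Smooth.
Context {R : realType} {d : nat}.
Local Notation XT := ('rV[R]_d * R)%type.
Implicit Types (v w : XT -> R) (k : option 'I_d) (z : XT).

(** The derivative along [u] is the ordinary derivative of the restriction to a
    line, so the chain rule on the real line applies. *)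
Lemma is_derive_comp_along {V : normedModType R} (h : V -> R) (p : R -> R)
    (z u : V) (dh dp : R) :
  is_derive z u h dh -> is_derive (h z) 1 p dp ->
  is_derive z u (p \o h) (dp * dh).
Proof.
have line (q : V -> R) : (fun t : R => t^-1 *: ((q \o shift z) (t *: u) - q z)) =
    (fun t => t^-1 *: (((fun s : R => q (s *: u + z)) \o shift 0) (t *: 1) -
                       q (0 *: u + z))).
  by apply/funext => t /=; rewrite addr0 scale0r add0r [_%:A]mulr1.
have isline (q : V -> R) dq : is_derive z u q dq <->
    is_derive (0 : R) 1 (fun s : R => q (s *: u + z)) dq.
  by split=> -[dq1 dq2]; split; move: dq1 dq2; rewrite /derivable /derive line.
move=> /isline hl pl; apply/isline; apply: is_derive1_comp.
by rewrite scale0r add0r.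
Qed.

Lemma C1st_intro v (dv : option 'I_d -> XT -> R) :
  (forall k z, is_derive z (dir k) v (dv k z)) -> continuous v ->
  (forall k, continuous (dv k)) -> C1st_on setT v.
Proof.
move=> hv cv cdv; split; first by move=> z _; exact: cv.
move=> k; split; first by move=> z _; exact: (ex_derive).
have -> : dst k v = dv k by apply/funext => z; exact: derive_val.
by move=> z _; exact: cdv.
Qed.

Lemma C1st_cont v : C1st_on setT v -> continuous v.
Proof. by move=> [+ _] z; apply. Qed.

Lemma C1st_is_derive v k z : C1st_on setT v -> is_derive z (dir k) v (dst k v z).
Proof. by move=> [_ /(_ k)[+ _]] => /(_ z I) ?; apply: DeriveDef. Qed.

Lemma C1st_dst_cont v k : C1st_on setT v -> continuous (dst k v).
Proof. by move=> [_ /(_ k)[_ +]] z; apply. Qed.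

Lemma C1st_cst (c : R) : C1st_on setT (fun _ : XT => c).
Proof.
apply: (@C1st_intro _ (fun _ _ => 0)); first exact: (@cst_continuous _ _ c).
by move=> k; exact: (@cst_continuous _ _ 0).
Qed.

Lemma C1stD v w : C1st_on setT v -> C1st_on setT w -> C1st_on setT (v \+ w).
Proof.
move=> hv hw.
apply: (@C1st_intro _ (fun k => dst k v \+ dst k w)).
- by move=> k z; apply: is_deriveD; exact: C1st_is_derive.
- by move=> z; apply: continuousD; exact: C1st_cont.
- by move=> k z; apply: continuousD; exact: C1st_dst_cont.
Qed.

Lemma C1stM v w : C1st_on setT v -> C1st_on setT w -> C1st_on setT (v \* w).
Proof.
move=> hv hw.
apply: (@C1st_intro _ (fun k => (v \* dst k w) \+ (w \* dst k v))).
- by move=> k z; apply: is_deriveM; exact: C1st_is_derive.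
- by move=> z; apply: continuousM; exact: C1st_cont.
- move=> k z; apply: continuousD; apply: continuousM;
    by [exact: C1st_dst_cont|exact: C1st_cont].
Qed.

Lemma C1st_comp (p dp : R -> R) v : (forall s : R, is_derive s 1 p (dp s)) ->
  continuous dp -> C1st_on setT v -> C1st_on setT (p \o v).
Proof.
move=> hp cdp hv.
apply: (@C1st_intro _ (fun k => (dp \o v) \* dst k v)).
- by move=> k z; apply: is_derive_comp_along; exact: C1st_is_derive.
- move=> z; apply: continuous_comp; first exact: C1st_cont.
  by apply/differentiable_continuous/derivable1_diffP; exact: ex_derive.
- move=> k z; apply: continuousM; last exact: C1st_dst_cont.
  by apply: continuous_comp; [exact: C1st_cont|exact: cdp].
Qed.

(** One notion for the functions all of whose space-time derivatives of order
    at most two exist and are continuous: unlike [C21_on], it treats all directions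
    alike, which makes its stability under products and compositions a
    consequence of that of [C1st_on]. *)
Definition C2all v := C1st_on setT v /\ forall k, C1st_on setT (dst k v).

Lemma C2all_cst (c : R) : C2all (fun _ => c).
Proof.
split; first exact: C1st_cst.
move=> k; rewrite (_ : dst k _ = fun=> 0); first exact: C1st_cst.
by apply/funext => z; rewrite /dst derive_cst.
Qed.

Lemma C2allD v w : C2all v -> C2all w -> C2all (v \+ w).
Proof.
move=> [v1 v2] [w1 w2]; split; first exact: C1stD.
move=> k; rewrite (_ : dst k _ = dst k v \+ dst k w).
  exact: (C1stD (v2 k) (w2 k)).
apply/funext => z.
by apply: (@derive_val _ _ _ _ _ _ _); apply: is_deriveD; exact: C1st_is_derive.
Qed.

Lemma C2allM v w : C2all v -> C2all w -> C2all (v \* w).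
Proof.
move=> [v1 v2] [w1 w2]; split; first exact: C1stM.
move=> k; rewrite (_ : dst k _ = (v \* dst k w) \+ (w \* dst k v)).
  exact: (C1stD (C1stM v1 (w2 k)) (C1stM w1 (v2 k))).
apply/funext => z.
by apply: (@derive_val _ _ _ _ _ _ _); apply: is_deriveM; exact: C1st_is_derive.
Qed.

(** By the chain rule, the first derivatives are the products of [dp \o v] and
    those of [v], all of them of class [C^1]. *)
Lemma C2all_comp (p dp ddp : R -> R) v : (forall s : R, is_derive s 1 p (dp s)) ->
  (forall s : R, is_derive s 1 dp (ddp s)) -> continuous ddp ->
  C2all v -> C2all (p \o v).
Proof.
move=> hp hdp cddp [v1 v2].
have cdp : continuous dp.
  by move=> s; apply/differentiable_continuous/derivable1_diffP; exact: ex_derive.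
split; first exact: C1st_comp v1.
move=> k; rewrite (_ : dst k _ = (dp \o v) \* dst k v).
  exact: (C1stM (C1st_comp hdp cddp v1) (v2 k)).
apply/funext => z.
by apply: (@derive_val _ _ _ _ _ _ _); apply: is_derive_comp_along; exact: C1st_is_derive.
Qed.

Lemma C2all_sum n (v : 'I_n -> XT -> R) :
  (forall i, C2all (v i)) -> C2all (fun z => \sum_(i < n) v i z).
Proof.
elim: n v => [|n ih] v hv.
  rewrite (_ : (fun z => _) = fun=> 0); first exact: C2all_cst.
  by apply/funext => z; rewrite big_ord0.
rewrite (_ : (fun z => _) =
    (fun z => \sum_(i < n) v (widen_ord (leqnSn n) i) z) \+ v ord_max).
  by apply: C2allD; [apply: ih => i; exact: hv|exact: hv].
by apply/funext => z; rewrite big_ord_recr.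
Qed.

Lemma C2all_linear (l : XT -> R) : (forall (z w : XT) (t : R), l (t *: z + w) = t * l z + l w) ->
  continuous l -> C2all l.
Proof.
move=> ll cl.
have hd k z : is_derive z (dir k) l (l (dir k)).
  have E : (fun h : R => h^-1 *: ((l \o shift z) (h *: (dir k : XT)) - l z)) @ 0^' -->
      l (dir k).
    apply: cvg_near_cst; near=> h => /=.
    rewrite ll addrK [_ *: _]mulrA mulVf ?mul1r//; near: h; exact: nbhs_dnbhs_neq.
  by split; [apply/cvg_ex; exists (l (dir k))|exact: cvg_lim E].
have dl k : dst k l = fun=> l (dir k) by apply/funext => z; exact: derive_val.
split; last by move=> k; rewrite dl; exact: C1st_cst.
apply: (@C1st_intro _ (fun k => fun=> l (dir k))) => // k; exact: (@cst_continuous _ _ (l (dir k))).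
Unshelve. all: by end_near. Qed.

Lemma C2all_time : C2all (fun z => z.2).
Proof. by apply: C2all_linear => // z; exact: cvg_snd. Qed.

Lemma C2all_space i : C2all (fun z => z.1 0 i).
Proof.
apply: C2all_linear => [z w t|z]; first by rewrite !mxE.
apply: (@continuous_comp _ _ _ (fun z : XT => z.1) (fun x : 'rV[R]_d => x 0 i) z).
  exact: cvg_fst.
exact: (@coord_continuous R 1 d 0 i).
Qed.

End Smooth.

Section Tanh.
Context {R : realType}.

(** With [tanh' = 1 - tanh ^ 2], all derivatives of [tanh] are polynomials in
    [tanh]. *)
Lemma is_derive_tanh (x : R) : is_derive x 1 tanh (1 - tanh x ^+ 2).
Proof.
have eN : is_derive x 1 (fun y : R => expR (- y)) (- expR (- x)).
  have := @is_derive1_comp R expR -%R x _ _ (is_derive_expR (- x)) (is_deriveNid x 1).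
  by rewrite mulrN1.
have e0 : expR x + expR (- x) != 0 by rewrite gt_eqF// addr_gt0// expR_gt0.
have n := is_deriveB (is_derive_expR x) eN.
have s := is_deriveD (is_derive_expR x) eN.
have i := @is_deriveV _ (expR + (fun y => expR (- y))) _ _ _ e0 s.
have H := is_deriveM n i; have {}H : is_derive x 1 tanh _ := H.
apply: (is_derive_eq H); rewrite /tanh /GRing.scale /= opprK.
rewrite -[(expR - _) x]/(expR x - expR (- x)).
rewrite -[(expR + _) x]/(expR x + expR (- x)).
by field.
Qed.

Lemma continuous_tanh : continuous (@tanh R).
Proof.
move=> x; apply/differentiable_continuous/derivable1_diffP.
exact: (@ex_derive _ _ _ _ _ _ _ (is_derive_tanh x)).
Qed.

Lemma is_derive_dtanh (x : R) :
  is_derive x 1 (fun y => 1 - tanh y ^+ 2) (- (2 * tanh x * (1 - tanh x ^+ 2))).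
Proof.
have t := is_derive_tanh x.
have H := is_deriveB (is_derive_cst (1 : R) x 1) (is_deriveX 2 t).
have {}H : is_derive x 1 (fun y => 1 - tanh y ^+ 2) _ := H.
by apply: (is_derive_eq H); rewrite sub0r expr1 /GRing.scale /=.
Qed.

Lemma continuous_ddtanh : continuous (fun x : R => - (2 * tanh x * (1 - tanh x ^+ 2))).
Proof.
move=> x; apply: cvgN; apply: cvgM.
  by apply: cvgM; [exact: cvg_cst|exact: continuous_tanh].
apply: cvgB; first exact: cvg_cst.
by apply: cvgM; exact: continuous_tanh.
Qed.

End Tanh.

Section Networks.
Context {R : realType} {d : nat}.
Local Notation XT := ('rV[R]_d * R)%type.

Lemma C2all_mlp n (N : mlp R n) (h : XT -> 'rV[R]_n) :
  (forall i, C2all (fun z => h z 0 i)) -> C2all (fun z => mlp_eval N (h z)).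
Proof.
elim: N h => {n} [n w b|n m W b N ih] h hh /=.
  apply: (@C2allD _ _ (fun z => (h z *m w) 0 0)); last exact: C2all_cst.
  rewrite (_ : (fun z => _) = fun z => \sum_k h z 0 k * w k 0); last first.
    by apply/funext => z; rewrite mxE.
  apply: C2all_sum => k; apply: (@C2allM _ _ (fun z => h z 0 k)) => //.
  exact: C2all_cst.
apply: ih => j.
rewrite (_ : (fun z => _) = tanh \o (fun z => \sum_k h z 0 k * W k j + b 0 j)); last first.
  by apply/funext => z; rewrite !mxE.
apply: (C2all_comp is_derive_tanh is_derive_dtanh continuous_ddtanh).
apply: (@C2allD _ _ (fun z => \sum_k h z 0 k * W k j)); last exact: C2all_cst.
apply: C2all_sum => k; apply: (@C2allM _ _ (fun z => h z 0 k)) => //.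
exact: C2all_cst.
Qed.

Lemma C2all_realize (N : net R d) : C2all (realize N).
Proof.
apply: C2all_mlp => i; case: (split_ordP i) => j ->.
  rewrite (_ : (fun z => _) = (fun z : XT => z.1 0 j)); first exact: C2all_space.
  by apply/funext => z; rewrite row_mxEl.
rewrite (_ : (fun z => _) = (fun z : XT => z.2)); first exact: C2all_time.
by apply/funext => z; rewrite row_mxEr ord1 mxE eqxx mulr1n.
Qed.

End Networks.

(** * Differences of functions and their traces *)

Section Differences.
Context {R : realType} {d : nat}.
Local Notation XT := ('rV[R]_d * R)%type.
Variable O : set XT.
Hypothesis openO : open O.
Implicit Types (v w : XT -> R) (k : option 'I_d) (z : XT).

Lemma near_open v w z : O z -> (forall x, O x -> v x = w x) -> \near z, v z = w z.
Proof.
by move=> Oz vw; apply: filterS (open_nbhs_nbhs (conj openO Oz)) => x /vw.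
Qed.

(** Values on an open set determine continuity at its points; this carries
    formulas valid on [O] only over to the total functions [dst k v]. *)
Lemma C0_on_eq v w : (forall z, O z -> v z = w z) -> C0_on O v -> C0_on O w.
Proof.
move=> vw cv z Oz; rewrite /prop_for /continuous_at -(vw z Oz).
by apply: cvg_trans (cv z Oz); apply: near_eq_cvg; exact: near_open.
Qed.

Lemma C0_onB v w : C0_on O v -> C0_on O w -> C0_on O (v \- w).
Proof. by move=> cv cw z Oz; apply: cvgB; [exact: cv|exact: cw]. Qed.

Lemma dst_onB k v w z : derivable v z (dir k) -> derivable w z (dir k) ->
  dst k (v \- w) z = dst k v z - dst k w z.
Proof. by move=> dv dw; exact: deriveB. Qed.

Lemma C1st_on_dstB k v w z : C1st_on O v -> C1st_on O w -> O z ->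
  dst k (v \- w) z = dst k v z - dst k w z.
Proof.
by move=> [_ /(_ k)[dv _]] [_ /(_ k)[dw _]] Oz; apply: dst_onB; [exact: dv|exact: dw].
Qed.

Lemma C1st_onB v w : C1st_on O v -> C1st_on O w -> C1st_on O (v \- w).
Proof.
move=> hv hw; split; first by apply: C0_onB; [case: hv|case: hw].
move=> k; split=> [z Oz|].
  by apply: derivableB; [case: hv => _ /(_ k)[+ _]|case: hw => _ /(_ k)[+ _]]; apply.
apply: (@C0_on_eq (dst k v \- dst k w)).
  by move=> z Oz; rewrite C1st_on_dstB.
by apply: C0_onB; [case: hv => _ /(_ k)[]|case: hw => _ /(_ k)[]].
Qed.

Lemma C21_on_dx2B i j v w z : C21_on O v -> C21_on O w -> O z ->
  dx i (dx j (v \- w)) z = dx i (dx j v) z - dx i (dx j w) z.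
Proof.
move=> [v1 v2] [w1 w2] Oz; rewrite /dx -dst_onB; last 2 first.
- by have [+ _] := v2 i j; apply.
- by have [+ _] := w2 i j; apply.
apply: near_eq_derive; apply: near_open => // x Ox; exact: C1st_on_dstB.
Qed.

Lemma C21_onB v w : C21_on O v -> C21_on O w -> C21_on O (v \- w).
Proof.
move=> hv hw; have [v1 v2] := hv; have [w1 w2] := hw; split; first exact: C1st_onB.
move=> i j; split=> [z Oz|].
  apply: (@near_eq_derivable _ _ _ (dx j v \- dx j w)).
    apply: near_open => // x Ox; apply/esym; exact: C1st_on_dstB.
  by apply: derivableB; [have [+ _] := v2 i j|have [+ _] := w2 i j]; apply.
apply: (@C0_on_eq (dx i (dx j v) \- dx i (dx j w))).
  by move=> z Oz; apply/esym; exact: C21_on_dx2B.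
by apply: C0_onB; [have [] := v2 i j|have [] := w2 i j].
Qed.

Lemma C21_on_dtB v w z : C21_on O v -> C21_on O w -> O z ->
  dt (v \- w) z = dt v z - dt w z.
Proof. by move=> [v1 _] [w1 _]; exact: C1st_on_dstB. Qed.

Lemma C21_on_lapxB v w z : C21_on O v -> C21_on O w -> O z ->
  lapx (v \- w) z = lapx v z - lapx w z.
Proof.
by move=> hv hw Oz; rewrite /lapx -sumrB; apply: eq_bigr => i _; exact: C21_on_dx2B.
Qed.

Lemma C2all_C21_on w : C2all w -> C21_on O w.
Proof.
move=> [w1 w2]; split.
  split; first by move=> z _; exact: (C1st_cont w1 (x := z)).
  move=> k; split=> [z _|z _]; last exact: (@C1st_dst_cont _ _ w k w1 z).
  by have [_ /(_ k)[+ _]] := w1; apply.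
move=> i j; split=> z _; last exact: (@C1st_dst_cont _ _ _ (Some i) (w2 (Some j)) z).
by have [_ /(_ (Some i))[+ _]] := w2 (Some j); apply.
Qed.

End Differences.

Section Classical.
Context {R : realType} {d : nat} (P : ocp R d).
Hypothesis hP : standing_assumptions P.
Local Notation XT := ('rV[R]_d * R)%type.
Implicit Types (v w : XT -> R) (z : XT).

Lemma open_Q : open (Q P).
Proof.
case: hP => -[oO _ _ _] _ _ _.
rewrite openE => z [z1 z2]; exists (Omega P, `]0, horizon P[%classic) => //.
split; first exact: open_nbhs_nbhs.
by apply: open_nbhs_nbhs; split => //; exact: interval_open.
Qed.

(** Lateral boundary points are adherent to [Q], so limits from inside [Q] are
    unique there. *)
Lemma Sig_proper z : Sig P z -> ProperFilter (within (Q P) (nbhs z)).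
Proof.
move=> [[z1 _] z2]; apply: Build_ProperFilter_ex => B [[U V] /= [Uz Vz] UVB].
have [x [Ox Ux]] := z1 U Uz.
exists (x, z.2); apply: (UVB (x, z.2)) => //=.
by split=> //; exact: nbhs_singleton.
Qed.

Lemma smooth_trace_cvg w i z : C2all w ->
  dx i w x @[x --> within (Q P) (nbhs z)] --> dx i w z.
Proof. by move=> [w1 _]; apply: cvg_within_filter; exact: (@C1st_dst_cont _ _ w (Some i) w1 z). Qed.

(** The gradient of [v] only has a limit from inside [Q], whereas that of [w] is
    continuous up to the boundary; the two formulas for the gradient of the
    difference agree inside [Q], which is all the limit sees. *)
Lemma classical_trace_cvgB v w i z : classical P v -> C2all w -> Sig P z ->
  dx i (v \- w) x @[x --> within (Q P) (nbhs z)] -->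
    trace (Q P) (dx i v) z - trace (Q P) (dx i w) z.
Proof.
move=> [_ v2 v3] hw Sz.
have prop := Sig_proper Sz.
have cw := @smooth_trace_cvg w i z hw.
have -> : trace (Q P) (dx i w) z = dx i w z by exact: cvg_lim cw.
apply: (@cvg_trans _ ((dx i v \- dx i w) x @[x --> within (Q P) (nbhs z)])); last first.
  by apply: cvgB => //; exact: v3.
apply: near_eq_cvg; rewrite near_withinE; apply: filterE => x Qx; apply/esym.
exact: (C1st_on_dstB (Some i) v2.1 (C2all_C21_on (Q P) hw).1 Qx).
Qed.

Lemma classicalB v w : classical P v -> C2all w -> classical P (v \- w).
Proof.
move=> cv hw; have [v1 v2 v3] := cv; split.
- move=> x; apply: cvgB; first exact: v1.
  by apply: continuous_subspaceT; exact: (C1st_cont hw.1).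
- exact: (C21_onB open_Q v2 (C2all_C21_on (Q P) hw)).
- move=> z Sz i; apply/cvg_ex.
  by eexists; exact: classical_trace_cvgB.
Qed.

Lemma dnB v w z : classical P v -> C2all w -> Sig P z ->
  dn P (v \- w) z = dn P v z - dn P w z.
Proof.
move=> cv hw Sz; rewrite /dn -sumrB; apply: eq_bigr => i _.
rewrite -mulrBl; congr (_ * _).
have prop := Sig_proper Sz.
exact: cvg_lim (classical_trace_cvgB cv hw Sz).
Qed.

End Classical.

(** * Norms over the space-time cylinder *)

Section LnormFacts.
Context d {T : measurableType d} {R : realType} (mu : {measure set T -> \bar R}).
Implicit Types f g : T -> R.

(** For a measure of total mass zero the norm is 0 by convention, but then every
    property holds almost everywhere. *)
Lemma Lnormy_ae_le f (M : R) :
  (Lnorm mu +oo (EFin \o f) <= M%:E)%E -> {ae mu, forall x, `|f x| <= M}.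
Proof.
rewrite unlock /=; case: ifPn => [_ /ess_supP|].
  by apply: filterS => x /=; rewrite lee_fin.
rewrite -leNgt => muT _; exists setT; split => //.
by apply/eqP; rewrite eq_le muT measure_ge0.
Qed.

Lemma Lnorm2_ae_le f g (c : R) :
  measurable_fun setT f -> measurable_fun setT g -> 0 <= c ->
  {ae mu, forall x, `|f x| <= c * `|g x|} ->
  (Lnorm mu 2%:E (EFin \o f) <= c%:E * Lnorm mu 2%:E (EFin \o g))%E.
Proof.
move=> mf mg c0 fg.
have msq (h : T -> R) : measurable_fun setT h ->
    measurable_fun setT (fun x => `|(EFin \o h) x| `^ 2)%E.
  move=> mh; apply: (@measurableT_comp _ _ _ _ _ _ (fun x : \bar R => x `^ 2)%E).
    exact: measurable_poweR.
  by do 2 apply: measurableT_comp => //.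
have cE : (c%:E = (c%:E `^ 2) `^ 2^-1)%E by rewrite -poweRrM mulfV// poweRe1.
have I0 h : (0 <= \int[mu]_x (`|(EFin \o h) x| `^ 2))%E.
  by apply: integral_ge0 => x _; exact: poweR_ge0.
have c20 : (0 <= c%:E `^ 2)%E by exact: poweR_ge0.
rewrite unlock [in leRHS]cE -poweRM//.
apply: gt0_ler_poweR; first by rewrite invr_ge0.
- by rewrite in_itv; apply/andP; split; [exact: I0|exact: leey].
- by rewrite in_itv; apply/andP; split; [exact: mule_ge0|exact: leey].
rewrite -ge0_integralZl//; last 2 first.
- exact: (msq g mg).
- by move=> x _; exact: poweR_ge0.
apply: ae_ge0_le_integral => //.
- by move=> x _; exact: poweR_ge0.
- exact: (msq f mf).
- by move=> x _; apply: mule_ge0 => //; exact: poweR_ge0.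
- by apply: measurable_funeM; exact: (msq g mg).
apply: filterS fg => x fgx _; rewrite -poweRM ?abse_ge0//.
apply: gt0_ler_poweR => //; rewrite ?in_itv/= ?leey ?andbT ?abse_ge0 ?mule_ge0//.
Qed.

End LnormFacts.

Section L2.
Context {R : realType} {n : nat} (P : ocp R n).
Hypothesis hP : standing_assumptions P.
Hypothesis oQ : open (Q P).
Local Notation XT := ('rV[R]_n * R)%type.
Local Notation LXR := (caratheodory_type (@lebO R n) * measurableTypeR R)%type.
Implicit Types (v w : XT -> R) (z : XT).
Local Notation mfun v := (measurable_fun (Q P : set LXR) v).

Lemma Q_measurable : measurable (Q P : set LXR).
Proof. exact: open_spacetime_measurable. Qed.

Lemma restrict_measurable v : mfun v ->
  measurable_fun ([set: XT] : set LXR) (v \_ (Q P)).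
Proof. by move=> mv; apply/(measurable_restrictT _ Q_measurable). Qed.

Lemma L2Q_ge0 v : (0 <= L2Q P v)%E. Proof. exact: Lnorm_ge0. Qed.

Lemma L2Q_ae_le v w c : mfun v -> mfun w -> 0 <= c ->
  {ae stvol, forall z : LXR, Q P z -> `|v z| <= c * `|w z|} ->
  (L2Q P v <= c%:E * L2Q P w)%E.
Proof.
move=> mv mw c0 vw; apply: Lnorm2_ae_le => //.
- exact: restrict_measurable.
- exact: restrict_measurable.
apply: filterS vw => z vwz; rewrite !patchE; case: ifPn => [/set_mem /vwz//|_].
by rewrite normr0 mulr0.
Qed.

Lemma L2QD v w : mfun v -> mfun w -> (L2Q P (v \+ w)%R <= L2Q P v + L2Q P w)%E.
Proof.
move=> mv mw; have mQ := Q_measurable.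
rewrite /L2Q (_ : (v \+ w) \_ (Q P) = (v \_ (Q P)) \+ (w \_ (Q P))); last first.
  by apply/funext => z; rewrite /= !patchE; case: ifPn => // _; rewrite addr0.
by apply: minkowski_EFin; [exact: restrict_measurable|exact: restrict_measurable|lra].
Qed.

Lemma L2QN v : L2Q P (fun z => - v z) = L2Q P v.
Proof.
rewrite /L2Q -[RHS]oppe_Lnorm; apply: eq_Lnorm => z /=.
by rewrite !patchE; case: ifPn => // _; rewrite oppr0.
Qed.

Lemma L2QB v w : mfun v -> mfun w -> (L2Q P (v \- w)%R <= L2Q P v + L2Q P w)%E.
Proof.
move=> mv mw; rewrite -(L2QN w).
by apply: (@L2QD v (fun z => - w z)) => //; exact: measurableT_comp.
Qed.

Lemma LooQ_ae_le v M : (LooQ P v <= M%:E)%E ->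
  {ae stvol, forall z : LXR, Q P z -> `|v z| <= M}.
Proof.
move=> /Lnormy_ae_le; apply: filterS => z + Qz.
by rewrite patchE mem_set.
Qed.

(** [Omega] is bounded, hence lies in a box. *)
Lemma stvol_Q_lty : (stvol (Q P : set LXR) < +oo)%E.
Proof.
have [[_ _ _ [M [_ bO]]] _ _ _] := hP.
pose a : 'rV[R]_n := const_mx (- (`|M| + 2)).
pose b : 'rV[R]_n := const_mx (`|M| + 2).
have Ob : Omega P `<=` box a b.
  move=> x Ox i; rewrite !mxE.
  have := bO (`|M| + 1); rewrite (le_lt_trans (ler_norm M)) ?ltrDl//.
  move=> /(_ isT x Ox) xM.
  have xi : `|x 0 i| <= `|x|.
    rewrite [leRHS]/Num.norm /= mx_normrE; apply/bigmax_geP; right => /=.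
    by exists (0, i).
  have : `|x 0 i| <= `|M| + 1 by exact: le_trans xi xM.
  by rewrite ler_norml => /andP[h1 h2]; apply/andP; split; lra.
pose B : set LXR := (box a b : set (caratheodory_type (@lebO R n))) `*`
                    (`]0, horizon P[%classic : set (measurableTypeR R)).
apply: (@le_lt_trans _ _ (stvol B)).
  apply: le_measure; rewrite ?inE; first exact: Q_measurable.
    by apply: measurableX; [exact: box_measurable|exact: measurable_itv].
  by move=> z [z1 z2]; split=> //; exact: Ob.
have -> : stvol B = (spvol (box a b : set (caratheodory_type (@lebO R n))) *
    @lebesgue_measure R `]0%R, horizon P[%classic)%E.
  by apply: product_measure1E; [exact: box_measurable|exact: measurable_itv].
have fb : spvol (box a b : set (caratheodory_type (@lebO R n))) \is a fin_num.
  by rewrite ge0_fin_numE ?measure_ge0//; exact: leb_box_lty.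
apply: lte_mul_pinfty => //.
rewrite lebesgue_measure_itv /=; case: ifPn => _; last exact: ltry.
exact: ltry.
Qed.

Lemma L2Q_lty v M : mfun v -> {ae stvol, forall z : LXR, Q P z -> `|v z| <= M} ->
  (L2Q P v < +oo)%E.
Proof.
move=> mv vM.
have le : (L2Q P v <= (`|M|%R)%:E * L2Q P (fun=> 1%R))%E.
  apply: L2Q_ae_le => //.
  by apply: filterS vM => z vz /vz; rewrite normr1 mulr1 => /le_trans; apply; exact: ler_norm.
apply: (le_lt_trans le); apply: lte_mul_pinfty => //.
rewrite /L2Q unlock; apply: poweR_lty.
rewrite (_ : (fun x => _) = (fun x => (\1_(Q P) x)%:E)).
  by rewrite integral_indic ?setIT; [exact: stvol_Q_lty|exact: measurableT|exact: Q_measurable].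
apply/funext => z /=; rewrite patchE indicE; case: ifPn => _ /=.
  by rewrite normr1 powR1.
by rewrite normr0 powR0.
Qed.

End L2.

(** * Taylor remainders of the nonlinearity *)

Section Taylor.
Context {R : realType}.
Implicit Types (f : R -> R) (a b c : R).

(** The mean value theorem, with the intermediate point located so that it
    inherits both the distance to [a] and any interval bounds, whichever of [a]
    and [b] is larger. *)
Lemma mean_value f a b : (forall x : R, derivable f x 1) ->
  exists c, [/\ `|c - a| <= `|b - a|,
    forall lo hi, lo <= a <= hi -> lo <= b <= hi -> lo <= c <= hi
    & f b - f a = derive1 f c * (b - a)].
Proof.
move=> df.
have mvt x y : x <= y -> exists2 c, c \in `[x, y] & f y - f x = derive1 f c * (y - x).
  move=> xy; apply: MVT_segment => //.
    by move=> t _; rewrite derive1E; exact: derivableP.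
  by apply: derivable_within_continuous => t _; exact: df.
have [ab|/ltW ba] := leP a b.
  have [c /itvP cab E] := mvt a b ab; exists c; split => //.
    by rewrite !ger0_norm ?subr_ge0 ?cab// lerB// cab.
  move=> lo hi /andP[la _] /andP[_ bh].
  by rewrite (le_trans la) ?cab//= (le_trans _ bh) ?cab.
have [c /itvP cba E] := mvt b a ba; exists c; split.
- by rewrite !ler0_norm ?subr_le0 ?cba// lerN2 lerB// cba.
- move=> lo hi /andP[_ ah] /andP[lb _].
  by rewrite (le_trans lb) ?cba//= (le_trans _ ah) ?cba.
- by rewrite -opprB E -mulrN opprB.
Qed.

(** Between [a] and [b] the Lipschitz bound keeps [f''] within [|L| r] of its
    value at [a]; the mean value theorem, applied to [f'] and then to [f], turns
    this into the three estimates. *)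
Lemma taylor_remainders f (L lo hi M2 r a b : R) :
  (forall x : R, derivable f x 1) -> (forall x : R, derivable (derive1 f) x 1) ->
  L.-lipschitz_(`[lo, hi]%classic) (derive1 (derive1 f)) ->
  lo <= a <= hi -> lo <= b <= hi -> `|derive1 (derive1 f) a| <= M2 -> `|b - a| <= r ->
  [/\ `|f b - f a - derive1 f a * (b - a)| <= (M2 + `|L| * r) * `|b - a| ^+ 2,
      `|derive1 f b - derive1 f a| <= (M2 + `|L| * r) * `|b - a|
    & `|derive1 f b - derive1 f a - derive1 (derive1 f) a * (b - a)| <=
        `|L| * `|b - a| ^+ 2].
Proof.
move=> df ddf lip aI bI Ma bar.
have lipa c : lo <= c <= hi -> `|c - a| <= `|b - a| ->
    `|derive1 (derive1 f) c - derive1 (derive1 f) a| <= `|L| * `|b - a|.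
  move=> cI ca; apply: (@le_trans _ _ (`|L| * `|c - a|)); last by rewrite ler_wpM2l.
  apply: (@le_trans _ _ (L * `|c - a|)); last by rewrite ler_wpM2r// ler_norm.
  by apply: (lip (c, a)); split; rewrite /= in_itv.
have second c : lo <= c <= hi -> `|c - a| <= `|b - a| ->
    `|derive1 (derive1 f) c| <= M2 + `|L| * r.
  move=> cI ca; rewrite -(subrK (derive1 (derive1 f) a) (derive1 (derive1 f) c)) addrC.
  apply: (le_trans (ler_normD _ _)); apply: lerD => //.
  by apply: (le_trans (lipa c cI ca)); rewrite ler_wpM2l.
have first c : lo <= c <= hi -> `|c - a| <= `|b - a| ->
    `|derive1 f c - derive1 f a| <= (M2 + `|L| * r) * `|c - a|.
  move=> cI ca; have [e [ea eI ->]] := mean_value a c ddf.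
  rewrite normrM ler_wpM2r//; apply: second; first exact: eI.
  exact: le_trans ea ca.
split.
- have [c [ca cI ->]] := mean_value a b df.
  rewrite -mulrBl normrM expr2 mulrA ler_wpM2r//.
  apply: (le_trans (first c (cI _ _ aI bI) ca)); rewrite ler_wpM2l//.
  by apply: le_trans (second a aI _); rewrite ?subrr ?normr0.
- exact: first.
- have [c [ca cI ->]] := mean_value a b ddf.
  by rewrite -mulrBl normrM expr2 mulrA ler_wpM2r// lipa// cI.
Qed.

End Taylor.

(** * The linear system satisfied by the errors *)

Section ErrorSystem.
Context {R : realType} {d : nat} (P : ocp R d).
Hypothesis hP : standing_assumptions P.
Local Notation XT := ('rV[R]_d * R)%type.
Local Notation f := (nonlin P).
Implicit Types (y l u Y Lam U : XT -> R) (z : XT).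

Lemma compact_Qbar : compact (Qbar P).
Proof.
have [[_ _ _ [M [Mr bO]]] _ _ _] := hP.
apply: compact_setX; last exact: segment_compact.
apply: bounded_closed_compact; last exact: closed_closure.
exists M; split => // B MB x; rewrite closureE => /(_ [set x | `|x| <= B]); apply.
split; last by move=> y Oy; exact: bO MB y Oy.
apply: (@closed_comp _ _ (fun x : 'rV[R]_d => `|x|) [set r | r <= B]).
  by move=> y _; exact: norm_continuous.
exact: closed_le.
Qed.

Lemma bounded_on_Qbar (v : XT -> R) : {within Qbar P, continuous v} ->
  exists2 M, 0 <= M & forall z, Qbar P z -> `|v z| <= M.
Proof.
move=> cv; have := compact_bounded (continuous_compact cv compact_Qbar).
move=> [M [Mr bM]]; exists (`|M| + 1); first by rewrite addr_ge0.
move=> z Qz; apply: (bM (`|M| + 1)); last by exists z.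
by rewrite (le_lt_trans (ler_norm M))// ltrDl.
Qed.

(** These are the terms [q_y] and [q_l] of the error system.  In the second one
    the difference [f'(Y) Lam - f'(y) l] is expanded around the fixed multiplier
    [l], so that its size is controlled by a bound on [l] and the error of [Lam]
    enters only multiplied by the error of [Y]. *)
Definition state_remainder y Y z : R :=
  f (Y z) - f (y z) - derive1 f (y z) * (Y z - y z).

Definition adjoint_remainder y l Y Lam z : R :=
  (derive1 f (Y z) - derive1 f (y z) - derive1 (derive1 f) (y z) * (Y z - y z)) * l z
  - (derive1 f (Y z) - derive1 f (y z)) * (l z - Lam z).

Lemma state_error_eq y Y z : C21_on (Q P) y -> C21_on (Q P) Y ->
  Q P z -> residual_y P y z = 0 ->
  dt (y \- Y) z - nu P * lapx (y \- Y) z + derive1 f (y z) * (y \- Y) z =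
  state_remainder y Y z - residual_y P Y z.
Proof.
move=> hy hY Qz; rewrite /residual_y => eqy.
rewrite (C21_on_dtB hy hY Qz) (C21_on_lapxB (open_Q hP) hy hY Qz) /=.
rewrite /state_remainder.
have -> : dt y z = nu P * lapx y z - f (y z) + source P z by lra.
move: (lapx y z) (lapx Y z) (dt Y z) (f (y z)) (f (Y z)) (derive1 f (y z)).
move: (y z) (Y z) (source P z) (nu P) => *; ring.
Qed.

Lemma adjoint_error_eq y l Y Lam z : C21_on (Q P) l -> C21_on (Q P) Lam ->
  Q P z -> residual_l P y l z = 0 ->
  - dt (l \- Lam) z - nu P * lapx (l \- Lam) z + derive1 f (y z) * (l \- Lam) z
    + (derive1 (derive1 f) (y z) * l z + 1) * (y \- Y) z =
  adjoint_remainder y l Y Lam z - residual_l P Y Lam z.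
Proof.
move=> hl hL Qz; rewrite /residual_l => eql.
rewrite (C21_on_dtB hl hL Qz) (C21_on_lapxB (open_Q hP) hl hL Qz) /=.
rewrite /adjoint_remainder.
have -> : dt l z = - nu P * lapx l z + derive1 f (y z) * l z + y z - target P z by lra.
move: (derive1 (derive1 f) (y z)) (derive1 f (y z)) (derive1 f (Y z)).
move: (lapx l z) (lapx Lam z) (dt Lam z) (y z) (Y z) (l z) (Lam z) (target P z) (nu P) => *; ring.
Qed.

End ErrorSystem.

Section Bound.
Context {R : realType} {d : nat} (P : ocp R d).
Hypothesis hP : standing_assumptions P.
Local Notation XT := ('rV[R]_d * R)%type.
Local Notation LXR := (caratheodory_type (@lebO R d) * measurableTypeR R)%type.
Local Notation f := (nonlin P).
Local Notation mfun v := (measurable_fun (Q P : set LXR) v).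
Implicit Types (y l u Y Lam U : XT -> R) (z : XT).

Hypothesis df : forall x : R, derivable f x 1.
Hypothesis ddf : forall x : R, derivable (derive1 f) x 1.
Hypothesis cddf : continuous (derive1 (derive1 f)).

Let cf : continuous f.
Proof. by move=> x; apply/differentiable_continuous/derivable1_diffP. Qed.

Let cdf : continuous (derive1 f).
Proof. by move=> x; apply/differentiable_continuous/derivable1_diffP. Qed.

Lemma C0_on_comp (g : R -> R) y : continuous g -> C0_on (Q P) y -> C0_on (Q P) (g \o y).
Proof. by move=> cg cy z Qz; apply: continuous_comp; [exact: cy|exact: cg]. Qed.

Lemma C0_on_Q_measurable y : C0_on (Q P) y -> mfun y.
Proof. exact: (C0_on_measurable (open_Q hP)). Qed.

Lemma C0_on_remainders y l Y Lam : C0_on (Q P) y -> C0_on (Q P) l ->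
  C0_on (Q P) Y -> C0_on (Q P) Lam ->
  C0_on (Q P) (state_remainder P y Y) /\ C0_on (Q P) (adjoint_remainder P y l Y Lam).
Proof.
move=> cy cl cY cL.
have [fy fY] := (C0_on_comp cf cy, C0_on_comp cf cY).
have [f1y f1Y] := (C0_on_comp cdf cy, C0_on_comp cdf cY).
have f2y := C0_on_comp cddf cy.
split=> z Qz.
  apply: cvgB; last by apply: cvgM; [exact: f1y|apply: cvgB; [exact: cY|exact: cy]].
  by apply: cvgB; [exact: fY|exact: fy].
have dY : {for z, continuous (fun z => Y z - y z)}.
  by apply: cvgB; [exact: cY|exact: cy].
have d1 : {for z, continuous (fun z => derive1 f (Y z) - derive1 f (y z))}.
  by apply: cvgB; [exact: f1Y|exact: f1y].
apply: cvgB; apply: cvgM.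
- by apply: cvgB; [exact: d1|apply: cvgM; [exact: f2y|exact: dY]].
- exact: cl.
- exact: d1.
- by apply: cvgB; [exact: cl|exact: cL].
Qed.

Lemma residual_y_measurable Y : inL2Q P (source P) -> C2all Y -> mfun (residual_y P Y).
Proof.
move=> [mg _] hY.
have [Y1 Y2] := C2all_C21_on (Q P) hY.
have mY : mfun Y by apply: C0_on_Q_measurable; case: Y1.
have mdt : mfun (dt Y) by apply: C0_on_Q_measurable; have [_ /(_ None)[]] := Y1.
have mlap : mfun (lapx Y).
  by apply: measurable_sum => i; apply: C0_on_Q_measurable; have [] := Y2 i i.
have mfY : mfun (f \o Y) by exact: C0_on_Q_measurable (C0_on_comp cf Y1.1).
apply: measurable_funB => //; apply: measurable_funD => //.
by apply: measurable_funB => //; exact: measurable_funM.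
Qed.

Lemma residual_l_measurable Y Lam : inL2Q P (target P) -> C2all Y -> C2all Lam ->
  mfun (residual_l P Y Lam).
Proof.
move=> [mg _] hY hL.
have [Y1 Y2] := C2all_C21_on (Q P) hY.
have [L1 L2] := C2all_C21_on (Q P) hL.
have mY : mfun Y by apply: C0_on_Q_measurable; case: Y1.
have mL : mfun Lam by apply: C0_on_Q_measurable; case: L1.
have mdt : mfun (dt Lam) by apply: C0_on_Q_measurable; have [_ /(_ None)[]] := L1.
have mlap : mfun (lapx Lam).
  by apply: measurable_sum => i; apply: C0_on_Q_measurable; have [] := L2 i i.
have mfY : mfun (derive1 f \o Y) by exact: C0_on_Q_measurable (C0_on_comp cdf Y1.1).
apply: measurable_funB => //; apply: measurable_funD => //.
apply: measurable_funD; last exact: measurable_funM.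
apply: measurable_funB; first exact: measurableT_comp.
exact: measurable_funM.
Qed.

(** The pointwise bounds are quadratic in the errors.  The errors are at most
    [rho] almost everywhere, so one factor may be replaced by [rho]; the other
    one is always taken to be the state error. *)
Lemma remainders_le y l Y Lam (L lo hi M2 Ml rho : R) :
  classical P y -> classical P l -> C2all Y -> C2all Lam ->
  0 <= rho -> 0 <= M2 -> 0 <= Ml ->
  (forall z, Q P z -> `|derive1 (derive1 f) (y z)| <= M2) ->
  (forall z, Q P z -> `|l z| <= Ml) ->
  (LooQ P (Y \- y)%R + LooQ P (Lam \- l)%R <= rho%:E)%E ->
  (forall z, Q P z -> lo <= y z <= hi) -> (forall z, Q P z -> lo <= Y z <= hi) ->
  L.-lipschitz_(`[lo, hi]%classic) (derive1 (derive1 f)) ->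
  let K := M2 + `|L| * rho in
  [/\ (L2Q P (y \- Y)%R < +oo)%E,
      (L2Q P (state_remainder P y Y) <= (K * rho)%:E * L2Q P (y \- Y)%R)%E
    & (L2Q P (adjoint_remainder P y l Y Lam) <=
        ((K + `|L| * Ml) * rho)%:E * L2Q P (y \- Y)%R)%E].
Proof.
move=> cy cl hY hL r0 M20 Ml0 hM2 hMl hrho yI YI lip K.
have cqy : C0_on (Q P) y by case: cy => _ [[]].
have cql : C0_on (Q P) l by case: cl => _ [[]].
have cqY : C0_on (Q P) Y by move=> z _; exact: (C1st_cont hY.1 (x := z)).
have cqL : C0_on (Q P) Lam by move=> z _; exact: (C1st_cont hL.1 (x := z)).
have [crs cra] := C0_on_remainders cqy cql cqY cqL.
have me : mfun (y \- Y) by exact: C0_on_Q_measurable (C0_onB cqy cqY).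
have L0 (v : XT -> R) : (0 <= LooQ P v)%E by exact: Lnorm_ge0.
have aeY : {ae stvol, forall z : LXR, Q P z -> `|Y z - y z| <= rho}.
  by apply: (@LooQ_ae_le _ _ P (Y \- y)); apply: le_trans hrho; exact: leeDl.
have aeL : {ae stvol, forall z : LXR, Q P z -> `|Lam z - l z| <= rho}.
  by apply: (@LooQ_ae_le _ _ P (Lam \- l)); apply: le_trans hrho; exact: leeDr.
have K0 : 0 <= K by rewrite addr_ge0// mulr_ge0.
have oQ := open_Q hP.
split.
- apply: (L2Q_lty hP oQ me (M := rho)).
  by apply: filterS aeY => z + Qz => /(_ Qz); rewrite distrC.
- apply: (L2Q_ae_le oQ) => //; [exact: C0_on_Q_measurable|exact: mulr_ge0|].
  apply: filterS aeY => z + Qz => /(_ Qz) Yy.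
  have [+ _ _] := taylor_remainders df ddf lip (yI z Qz) (YI z Qz) (hM2 z Qz) Yy.
  move=> /le_trans; apply; rewrite expr2 -[leRHS]mulrA ler_wpM2l//=.
  by rewrite (distrC (y z)) ler_wpM2r.
- apply: (L2Q_ae_le oQ) => //; first exact: C0_on_Q_measurable.
    by rewrite mulr_ge0// addr_ge0// mulr_ge0.
  near=> z => Qz.
  have Yy : `|Y z - y z| <= rho by move: Qz; near: z.
  have Ll : `|Lam z - l z| <= rho by move: Qz; near: z.
  have [_ h1 h2] := taylor_remainders df ddf lip (yI z Qz) (YI z Qz) (hM2 z Qz) Yy.
  apply: (le_trans (ler_normB _ _)); rewrite !normrM.
  have t1 : `|derive1 f (Y z) - derive1 f (y z) -
      derive1 (derive1 f) (y z) * (Y z - y z)| * `|l z| <=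
      (`|L| * (rho * `|Y z - y z|)) * Ml.
    apply: ler_pM => //; last exact: hMl.
    by apply: (le_trans h2); rewrite ler_wpM2l// expr2 ler_wpM2r.
  have t2 : `|derive1 f (Y z) - derive1 f (y z)| * `|l z - Lam z| <=
      (K * `|Y z - y z|) * rho.
    by apply: ler_pM => //; rewrite distrC.
  apply: (le_trans (lerD t1 t2)); rewrite /= (distrC (y z)).
  rewrite [leLHS](_ : _ = (K + `|L| * Ml) * rho * `|Y z - y z|)//.
  by move: `|Y z - y z| => e; ring.
Unshelve. all: by end_near. Qed.

End Bound.

(** * Absorption of the quadratic terms *)

(** The state error enters the error norm through a nonnegative summand. *)
Lemma L2Q_le_error_norm (R : realType) d (P : ocp R d) (ey el eu : 'rV[R]_d * R -> R) :
  (L2Q P ey <= error_norm P ey el eu)%E.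
Proof.
have sq0 (x : \bar R) : (0 <= x -> 0 <= x ^+ 2)%E by exact: expe_ge0.
have n0 v : (0 <= L2Q P v)%E := L2Q_ge0 P v.
have s0 : (0 <= L2Sig P eu)%E by exact: Lnorm_ge0.
have rest : (0 <= L2Q P el ^+ 2 + \sum_(i < d) L2Q P (dx i el) ^+ 2)%E.
  by apply: adde_ge0; [exact: sq0|apply: sume_ge0 => i _; exact: sq0].
have -> : L2Q P ey = ((L2Q P ey ^+ 2) `^ 2^-1)%E.
  have := n0 ey; case: (L2Q P ey) => [x|_|//].
    rewrite lee_fin => x0; rewrite -EFin_expe poweR_EFin powR12_sqrt ?sqr_ge0//.
    by rewrite sqrtr_sqr ger0_norm.
  by rewrite expe2 mulyy poweRyr// invr_neq0.
apply: gt0_ler_poweR; first by rewrite invr_ge0.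
- by rewrite in_itv; apply/andP; split; [exact: sq0|exact: leey].
- rewrite in_itv; apply/andP; split; last exact: leey.
  by apply: adde_ge0; [apply: adde_ge0 => //|]; exact: sq0.
by rewrite -addeA; apply: leeDl; apply: adde_ge0 => //; exact: sq0.
Qed.

(** [E] is a priori an extended real; it is bounded by [C F + C' M], which is
    finite as soon as [S] and [X] are, and only then may [E / 2] be subtracted. *)
Lemma absorb (R : realType) (C C' M c rho : R) (E X S F : \bar R) :
  0 < C -> 0 <= c -> C * (c * rho) <= 2^-1 -> 0 <= rho ->
  (0 <= S)%E -> (0 <= X)%E -> (X < +oo)%E -> (X <= E)%E ->
  (F <= S + (c * rho)%:E * X)%E ->
  (E <= C%:E * F + (C' * M)%:E)%E ->
  (E <= (2 * C)%:E * S + (2 * C' * M)%:E)%E.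
Proof.
move=> C0 c0 Cc r0 S0 X0 Xoo XE FS EF.
case: S S0 FS => [s|_ _|//]; last by rewrite mulry gtr0_sg ?mulr_gt0// mul1e addye// leey.
rewrite lee_fin => s0.
case: X X0 Xoo XE => [x|_|//]; last by rewrite ltxx.
rewrite lee_fin => x0 _ xE FS.
have {EF} : (E <= (C * (s + c * rho * x) + C' * M)%:E)%E.
  apply: (le_trans EF); rewrite EFinD leeD2r// EFinM lee_wpmul2l ?lee_fin ?(ltW C0)//.
case: E xE => [e|_|_]; last by move=> _; rewrite leNye.
  rewrite -!EFinM -EFinD !lee_fin => xe ee.
  have : C * (c * rho) * x <= 2^-1 * e.
    apply: (le_trans (ler_wpM2r x0 Cc)); by rewrite ler_wpM2l.
  move: ee; rewrite mulrDr mulrA => ee xx.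
  have -> : 2 * C * s + 2 * C' * M = 2 * (C * s + C' * M) by ring.
  rewrite mulrA in ee; lra.
by rewrite leye_eq.
Qed.

Lemma residual_sum_le (R : realType) (A F1 F2 a1 a2 b1 b2 U B : \bar R) :
  (F1 <= b1 + a1 -> F2 <= b2 + a2 ->
   A + F1 + F2 + U + B <= A + a1 + a2 + U + B + (b1 + b2))%E.
Proof.
move=> h1 h2; apply: (@le_trans _ _ (A + (b1 + a1) + (b2 + a2) + U + B)%E).
  by do 2 apply: leeD2r; apply: leeD => //; exact: leeD2l.
rewrite -!addeA; apply: leeD2l; rewrite addeCA; apply: leeD2l.
rewrite [(b2 + _)%E]addeCA addeCA; apply: leeD2l.
by rewrite [leLHS]addeA [leLHS]addeC -addeA.
Qed.

Unset Implicit Arguments.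
Set Strict Implicit.

Theorem theorem2 (R : realType) (d : nat) (P : ocp R d)
    (ystar lstar ustar : 'rV[R]_d * R -> R) (cf C2 C3 Cstab Cstab' L : R)
    (hd : (0 < d)%N)
    (hP : standing_assumptions P)
    (hKKT : reference_KKT P ystar lstar ustar)
    (hreg : regularity_compatibility P ustar)
    (hf : nonlinearity P cf)
    (hC2 : 0 < C2) (hC3 : 0 < C3) (hCstab : 0 < Cstab) :
  let a : 'rV[R]_d * R -> R := fun z => derive1 (nonlin P) (ystar z) in
  let kappa : 'rV[R]_d * R -> R :=
    fun z => derive1 (derive1 (nonlin P)) (ystar z) * lstar z in
  (alpha0 P kappa C2 C3 < alpha P ->
     linearized_stability P a kappa Cstab Cstab') ->
  alpha0 P kappa C2 C3 < alpha P ->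
  exists2 Cnl : R, 0 < Cnl &
  let rho0 := 1 / (2 * Cstab * Cnl) in
  0 < rho0 /\
  forall (utilde : 'rV[R]_d * R -> R) (class trained : nat -> set (triple R d))
         (Mbc lo hi rho : R),
    is_extension P ustar utilde ->
    approximability P ystar lstar utilde class ->
    (forall N, trained N `<=` class N) ->
    (forall N tr, trained N tr -> trace_residual_bound P tr Mbc) ->
    local_neighborhood P ystar lstar (\bigcup_N trained N) lo hi L rho ->
    rho <= rho0 ->
    forall N tr, trained N tr ->
      (triple_error P ystar lstar ustar tr
        <= (2 * Cstab)%:E * triple_residual P tr + (2 * Cstab' * Mbc)%:E)%E.
Proof.
move=> a kappa stab0 ha; have {stab0 ha} stab := stab0 ha.
have [_ _ [cy cl] eqQ [eqS eqO]] := hKKT.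
have [df ddf cddf _ bddf] := hf.
have [_ _ _ [hg hyd _]] := hP.
have QQb : Q P `<=` Qbar P.
  move=> z [z1 z2]; split; first exact: subset_closure.
  by move: z2; rewrite /= !in_itv => /andP[z20 z2T]; apply/andP; split; exact: ltW.
have [By By0 hBy] : exists2 M, 0 <= M & forall z, Qbar P z -> `|ystar z| <= M.
  by apply: bounded_on_Qbar hP _ _; case: cy.
have [Ml Ml0 hMl] : exists2 M, 0 <= M & forall z, Qbar P z -> `|lstar z| <= M.
  by apply: bounded_on_Qbar hP _ _; case: cl.
have [M2 M20 hM2] : exists2 M, 0 <= M &
    forall z, Q P z -> `|derive1 (derive1 (nonlin P)) (ystar z)| <= M.
  have /bddf[M [_ bM]] : bounded_set [set s : R | `|s| <= By].
    by exists By; split=> [|B /ltW BB s /= sB]; [exact: num_real|exact: le_trans BB].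
  exists (`|M| + 1); first by rewrite addr_ge0.
  move=> z /QQb Qz; apply: (bM (`|M| + 1)).
    by rewrite (le_lt_trans (ler_norm M))// ltrDl.
  by exists (ystar z) => //; exact: hBy.
(* Since Cnl >= 1, the radius is at most 1 / (2 Cstab); hence K bounds f'' at all
   the points between y* and the trained states, independently of rho. *)
pose K := M2 + `|L| * (2 * Cstab)^-1.
pose Cnl := 1 + (K + (K + `|L| * Ml)).
have K0 : 0 <= K by rewrite addr_ge0// mulr_ge0// invr_ge0 mulr_ge0// ltW.
have Cnl1 : 1 <= Cnl by rewrite lerDl; apply: addr_ge0 => //; apply: addr_ge0 => //; exact: mulr_ge0.
have Cnl0 : 0 < Cnl by exact: lt_le_trans Cnl1.
exists Cnl => // rho0; have rho00 : 0 < rho0 by rewrite divr_gt0 ?mulr_gt0.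
split=> // utilde class trained Mbc lo hi rho _ _ _ htr [r0 hrho yI YI lip] rr0 N tr Ntr.
have tru : (\bigcup_N trained N) tr by exists N.
have rK : rho <= (2 * Cstab)^-1.
  apply: (le_trans rr0); rewrite /rho0 div1r lef_pV2 ?posrE ?mulr_gt0//.
  by rewrite ler_peMr// ltW// mulr_gt0.
have CC : Cstab * (Cnl * rho) <= 2^-1.
  have : Cstab * (Cnl * rho) <= Cstab * (Cnl * rho0) by rewrite !ler_wpM2l// ltW.
  move=> /le_trans; apply; rewrite /rho0 le_eqVlt; apply/orP; left; apply/eqP.
  by field; rewrite !gt_eqF.
pose Y := Ynet tr; pose Lam := Lnet tr; pose U := Unet tr.
have hY : C2all Y by exact: C2all_realize.
have hL : C2all Lam by exact: C2all_realize.
have [eoo le1 le2] := remainders_le hP df ddf cddf cy cl hY hL (ltW r0) M20 Ml0 hM2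
  (fun z Qz => hMl z (QQb z Qz)) (hrho tr tru)
  (fun z Qz => yI z (QQb z Qz)) (fun z Qz => YI tr tru z (QQb z Qz)) lip.
have C21y : C21_on (Q P) ystar by case: cy.
have C21l : C21_on (Q P) lstar by case: cl.
have C0y : C0_on (Q P) ystar by case: C21y => -[].
have C0l : C0_on (Q P) lstar by case: C21l => -[].
have C0Y : C0_on (Q P) Y by case: (C2all_C21_on (Q P) hY) => -[].
have C0L : C0_on (Q P) Lam by case: (C2all_C21_on (Q P) hL) => -[].
have [/(C0_on_Q_measurable hP) mrs /(C0_on_Q_measurable hP) mra] :=
  C0_on_remainders df ddf cddf C0y C0l C0Y C0L.
have mRy := residual_y_measurable hP df hg hY.
have mRl := residual_l_measurable hP ddf hyd hY hL.
have oQ := open_Q hP.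
pose rs := state_remainder P ystar Y; pose ra := adjoint_remainder P ystar lstar Y Lam.
pose Ry := residual_y P Y; pose Rl := residual_l P Y Lam.
have n0 v : (0 <= L2Q P v)%E := L2Q_ge0 P v.
pose X := L2Q P (ystar \- Y).
pose ey0 x := init P x - Y (x, 0).
pose S := triple_residual P tr.
have S0 : (0 <= S)%E.
  by rewrite /S /triple_residual /total_residual; do !apply: adde_ge0; exact: Lnorm_ge0.
(* An infinite residual makes the bound trivial. *)
have [SE|Soo] := eqVneq S +oo%E.
  by rewrite -/S SE gt0_muley ?lte_fin ?mulr_gt0// addye// leey.
have Sfin : (S < +oo)%E by rewrite ltey.
have Ryoo : (L2Q P Ry < +oo)%E.
  apply: le_lt_trans Sfin; rewrite /S /triple_residual /total_residual.
  rewrite -!addeA addeCA; apply: leeDl.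
  by do !apply: adde_ge0; exact: Lnorm_ge0.
have Rloo : (L2Q P Rl < +oo)%E.
  apply: le_lt_trans Sfin; rewrite /S /triple_residual /total_residual.
  rewrite -!addeA [(L2Q _ _ + (L2Q _ _ + _))%E]addeCA addeCA; apply: leeDl.
  by do !apply: adde_ge0; exact: Lnorm_ge0.
have rsoo : (L2Q P rs < +oo)%E.
  apply: (le_lt_trans le1); apply: lte_mul_pinfty => //.
  by rewrite lee_fin mulr_ge0 ?addr_ge0// ?mulr_ge0// ltW.
have raoo : (L2Q P ra < +oo)%E.
  apply: (le_lt_trans le2); apply: lte_mul_pinfty => //.
  by rewrite lee_fin !mulr_ge0 ?addr_ge0// ?mulr_ge0// ltW.
have F1 : inL2Q P (rs \- Ry).
  split; first exact: measurable_funB.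
  by apply: (le_lt_trans (L2QB oQ mrs mRy)); exact: lte_add_pinfty.
have F2 : inL2Q P (ra \- Rl).
  split; first exact: measurable_funB.
  by apply: (le_lt_trans (L2QB oQ mra mRl)); exact: lte_add_pinfty.
have cey : classical P (ystar \- Y) := classicalB hP cy hY.
have cel : classical P (lstar \- Lam) := classicalB hP cl hL.
have eqy z : Q P z -> dt (ystar \- Y) z - nu P * lapx (ystar \- Y) z
    + a z * (ystar \- Y) z = (rs \- Ry) z.
  by move=> Qz; exact: (state_error_eq hP C21y (C2all_C21_on _ hY) Qz (eqQ z Qz).1).
have eql z : Q P z -> - dt (lstar \- Lam) z - nu P * lapx (lstar \- Lam) z
    + a z * (lstar \- Lam) z + (kappa z + 1) * (ystar \- Y) z = (ra \- Rl) z.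
  move=> Qz.
  exact: (adjoint_error_eq hP Y C21l (C2all_C21_on _ hL) Qz (eqQ z Qz).2).
have bcy z : Sig P z -> (ystar \- Y) z = (ustar \- U) z - (Y \- U) z.
  by move=> Sz; have [_ yu _] := eqS z Sz; rewrite /= yu; lra.
have bcl z : Sig P z -> (lstar \- Lam) z = - Lam z.
  by move=> Sz; have [_ _ l0] := eqS z Sz; rewrite /= l0 sub0r.
have icy x : Omega P x -> (ystar \- Y) (x, 0) = ey0 x.
  by move=> Ox; rewrite /= (eqO x Ox).1.
have tcl x : Omega P x -> (lstar \- Lam) (x, horizon P) = - Lam (x, horizon P).
  by move=> Ox; rewrite /= (eqO x Ox).2 sub0r.
have equ z : Sig P z -> alpha P * (ustar \- U) z + nu P * dn P (lstar \- Lam) z =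
    - residual_u P Lam U z.
  move=> Sz; have [e0 _ _] := eqS z Sz; move: e0.
  rewrite /residual_u (dnB cl hL Sz) /=; move: (dn P lstar z) (dn P Lam z) => p q e0.
  by lra.
have est : (triple_error P ystar lstar ustar tr <=
    Cstab%:E * total_residual P ey0 (rs \- Ry)%R (ra \- Rl)%R (residual_u P Lam U) (Y \- U)%R
    + (Cstab' * Mbc)%:E)%E.
  exact: (stab (rs \- Ry) (ra \- Rl) (ystar \- Y) (lstar \- Lam) (ustar \- U)
    (Y \- U) Lam (residual_u P Lam U) ey0 (fun x => Lam (x, horizon P)) Mbc F1 F2
    (htr N tr Ntr) (fun x _ => erefl) cey cel eqy bcy icy eql bcl tcl equ).
apply: (absorb (X := X) (rho := rho) hCstab (ltW Cnl0) CC (ltW r0) S0 _ eoo _ _ est).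
- exact: n0.
- exact: L2Q_le_error_norm.
apply: (le_trans (residual_sum_le _ _ _ (L2QB oQ mrs mRy) (L2QB oQ mra mRl))).
apply: leeD2l; apply: (le_trans (leeD le1 le2)).
rewrite -ge0_muleDl ?lee_fin; last 2 first.
- by rewrite mulr_ge0 ?addr_ge0// ?mulr_ge0// ltW.
- by rewrite !mulr_ge0 ?addr_ge0// ?mulr_ge0// ltW.
apply: lee_wpmul2r; first exact: n0.
rewrite -EFinD lee_fin -mulrDl ler_wpM2r ?(ltW r0)//.
have h : M2 + `|L| * rho <= K by rewrite lerD2l ler_wpM2l.
by rewrite /Cnl; lra.
Qed.
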